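(* Let $s>0$. Then $$\lim_{n\to\infty}\frac{1}{2\sqrt n}\,\mathfrak{p}_n\bigl(2\sqrt n\,s\bigr)=\begin{cases}\dfrac1\pi\sqrt{1-s^2}, & \text{if } s<1,\\ 0, & \text{if } s>1,\end{cases}$$ where $\mathfrak{p}_n(r)$ is the radial density of the random point field with kernel $K_n$.
   Context: $\mathbb{H}$ denotes the real quaternions; $\Lambda\subset\mathbb{H}$ is the set of pure (imaginary) quaternions $z=x_1\mathbf i+x_2\mathbf j+x_3\mathbf k$, identified with $\mathbb{R}^3$. The background measure on $\Lambda$ is $d\mu(z)=f(z)\,dm(z)$, $f(z)=(2\pi)^{-3/2}e^{-|z|^2/2}$, with $m$ Lebesgue measure on $\mathbb{R}^3$. Polynomials are functions on $\Lambda$ of the form $P(z)=\sum_{k=0}^N z^ka_k$, $a_k\in\mathbb{H}$, with scalar product $\langle u,w\rangle=\int_\Lambda \overline{u(z)}w(z)\,d\mu(z)$. $P_n$ ($n\ge0$) denotes the (unique) system of monic polynomials (leading term $z^n$) with $\langle P_k,P_l\rangle=0$ for $k\ne l$, and $h_n=\langle P_n,P_n\rangle$. The kernel is $K_n(x,y)=\sum_{k=0}^{n}P_k(x)\overline{P_k(y)}/h_k$. The point field with kernel $K_n$ is the random point field on $\Lambda$ whose $k$-point correlation functions with respect to $\mu$ are $\mathrm{Det}_M[K_n(x_i,x_j)]_{1\le i,j\le k}$, where $\mathrm{Det}_M$ is the Dyson–Moore determinant of a self-dual quaternion matrix (the product of its real right eigenvalues). Its density with respect to Lebesgue measure on $\mathbb{R}^3$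 is $\rho_n(x)=K_n(x,x)f(x)$. The radial density is $$\mathfrak{p}_n(r)=\int_{rS^2}\rho_n(x)\,dA(x),$$ where $rS^2$ is the sphere of radius $r$ centered at the origin and $dA$ is the surface measure on $rS^2$ induced by Lebesgue measure on $\mathbb{R}^3$. *)

(* Defs.v *)
From HB Require Import structures.
From mathcomp Require Import all_boot all_order all_algebra.
From mathcomp Require Import all_classical all_reals all_analysis.
From mathcomp Require Import ring lra.
Import Order.TTheory GRing.Theory Num.Theory.
Import numFieldNormedType.Exports.

Set Implicit Arguments.
Unset Strict Implicit.
Unset Printing Implicit Defensive.

Local Open Scope classical_set_scope.
Local Open Scope ring_scope.

Record quat (R : Type) : Type := Quat { qre : R; qi : R; qj : R; qk : R }.

Definition quat_tuple (R : Type) (q : quat R) : R * R * R * R :=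
  (qre q, qi q, qj q, qk q).
Definition tuple_quat (R : Type) (t : R * R * R * R) : quat R :=
  let: (a, b, c, d) := t in Quat a b c d.

Lemma quat_tupleK (R : Type) : cancel (@quat_tuple R) (@tuple_quat R).
Proof. by case. Qed.

HB.instance Definition _ (R : realFieldType) :=
  Choice.copy (quat R) (can_type (@quat_tupleK R)).

Section QuatRing.
Variable R : realFieldType.
Implicit Types p q r : quat R.

Definition addq p q : quat R :=
  Quat (qre p + qre q) (qi p + qi q) (qj p + qj q) (qk p + qk q).
Definition oppq q : quat R := Quat (- qre q) (- qi q) (- qj q) (- qk q).

(* i^2 = j^2 = k^2 = ijk = -1 *)
Definition mulq p q : quat R :=
  Quat (qre p * qre q - qi p * qi q - qj p * qj q - qk p * qk q)
       (qre p * qi q + qi p * qre q + qj p * qk q - qk p * qj q)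
       (qre p * qj q - qi p * qk q + qj p * qre q + qk p * qi q)
       (qre p * qk q + qi p * qj q - qj p * qi q + qk p * qre q).

Definition conjq q : quat R := Quat (qre q) (- qi q) (- qj q) (- qk q).
Definition sqnormq q : R :=
  qre q ^+ 2 + qi q ^+ 2 + qj q ^+ 2 + qk q ^+ 2.
Definition invq q : quat R :=
  Quat (qre q / sqnormq q) (- qi q / sqnormq q)
       (- qj q / sqnormq q) (- qk q / sqnormq q).

Lemma addqA : associative addq.
Proof. by move=> p q r; rewrite /addq /= !addrA. Qed.
Lemma addqC : commutative addq.
Proof. by move=> p q; congr Quat; exact: addrC. Qed.
Lemma add0q : left_id (Quat 0 0 0 0) addq.
Proof. by case=> a b c d; rewrite /addq /= !add0r. Qed.
Lemma addNq : left_inverse (Quat 0 0 0 0) oppq addq.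
Proof. by case=> a b c d; rewrite /addq /= !addNr. Qed.

HB.instance Definition _ :=
  GRing.isZmodule.Build (quat R) addqA addqC add0q addNq.

Lemma mulqA : associative mulq.
Proof. by move=> p q r; congr Quat; rewrite /=; ring. Qed.
Lemma mul1q : left_id (Quat 1 0 0 0) mulq.
Proof. by case=> a b c d; congr Quat; rewrite /=; ring. Qed.
Lemma mulq1 : right_id (Quat 1 0 0 0) mulq.
Proof. by case=> a b c d; congr Quat; rewrite /=; ring. Qed.
Lemma mulqDl : left_distributive mulq addq.
Proof. by move=> p q r; congr Quat; rewrite /=; ring. Qed.
Lemma mulqDr : right_distributive mulq addq.
Proof. by move=> p q r; congr Quat; rewrite /=; ring. Qed.
Lemma oneq_neq0 : Quat 1 0 0 0 != 0 :> quat R.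
Proof. by apply/eqP => -[] /eqP; rewrite oner_eq0. Qed.

HB.instance Definition _ := GRing.Zmodule_isNzRing.Build (quat R)
  mulqA mul1q mulq1 mulqDl mulqDr oneq_neq0.

Lemma sqnormq_eq0 q : (sqnormq q == 0) = (q == 0).
Proof.
apply/eqP/eqP => [|->]; last by rewrite /sqnormq /= expr0n /= !addr0.
case: q => a b c d; rewrite /sqnormq /= => h.
have [[[ha hb] hc] hd] := (sqr_ge0 a, sqr_ge0 b, sqr_ge0 c, sqr_ge0 d).
have sq0 (t : R) : t ^+ 2 = 0 -> t = 0 by move/eqP; rewrite sqrf_eq0 => /eqP.
have a0 : a = 0 by apply: sq0; lra.
have b0 : b = 0 by apply: sq0; lra.
have c0 : c = 0 by apply: sq0; lra.
have d0 : d = 0 by apply: sq0; lra.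
by rewrite a0 b0 c0 d0.
Qed.

Lemma mulVq : {in [pred q | q != 0], left_inverse 1 invq *%R}.
Proof.
move=> q; rewrite inE -sqnormq_eq0 /sqnormq => q0.
by congr Quat; rewrite /= /sqnormq; field.
Qed.
Lemma divqq : {in [pred q | q != 0], right_inverse 1 invq *%R}.
Proof.
move=> q; rewrite inE -sqnormq_eq0 /sqnormq => q0.
by congr Quat; rewrite /= /sqnormq; field.
Qed.
Lemma unitqP p q : q * p = 1 /\ p * q = 1 -> p != 0.
Proof.
by move=> [+ _]; apply: contra_eqN => /eqP->; rewrite mulr0 eq_sym oner_eq0.
Qed.
Lemma invq_out : {in [predC [pred q | q != 0]], invq =1 id}.
Proof.
by move=> q; rewrite !inE negbK => /eqP ->; rewrite /invq /= oppr0 mul0r.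
Qed.

HB.instance Definition _ := GRing.NzRing_hasMulInverse.Build (quat R)
  mulVq divqq unitqP invq_out.

End QuatRing.

Section PointField.
Variable R : realType.

Definition R3 : Type := (measurableTypeR R * measurableTypeR R * measurableTypeR R)%type.

Definition lebesgue3 : {measure set R3 -> \bar R} :=
  ((@lebesgue_measure R \x @lebesgue_measure R) \x @lebesgue_measure R)%E.

Definition pureq (x : R3) : quat R := Quat 0 x.1.1 x.1.2 x.2.

Definition gauss (x : R3) : R :=
  (2 * pi) `^ (- (3 / 2)) * expR (- sqnormq (pureq x) / 2).

Definition mu_integral (g : R3 -> R) : R :=
  Rintegral lebesgue3 setT (fun x => g x * gauss x).

Definition mu_integralq (g : R3 -> quat R) : quat R :=
  Quat (mu_integral (fun x => qre (g x))) (mu_integral (fun x => qi (g x)))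
       (mu_integral (fun x => qj (g x))) (mu_integral (fun x => qk (g x))).

(* Coefficients act on the right of the powers; p.[z] from the library puts
   them on the left, which differs over a noncommutative ring. *)
Definition reval (p : {poly quat R}) (x : R3) : quat R :=
  \sum_(k < size p) pureq x ^+ k * p`_k.

Definition inner (p q : {poly quat R}) : quat R :=
  mu_integralq (fun x => conjq (reval p x) * reval q x).

Definition monic_orthogonal_system (P : nat -> {poly quat R}) : Prop :=
  (forall n, P n \is monic /\ size (P n) = n.+1) /\
  (forall k l, k <> l -> inner (P k) (P l) = 0).

Definition pf_kernel (P : nat -> {poly quat R}) (n : nat) (x y : R3) : quat R :=
  \sum_(k < n.+1)
    reval (P k) x * conjq (reval (P k) y) / inner (P k) (P k).

Lemma mulq_conj_real (q : quat R) :
  q * conjq q = Quat (sqnormq q) 0 0 0 /\ conjq q * q = Quat (sqnormq q) 0 0 0.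
Proof. by split; congr Quat; rewrite /sqnormq /=; ring. Qed.

Lemma inner_real (p : {poly quat R}) :
  inner p p = Quat (mu_integral (fun x => sqnormq (reval p x))) 0 0 0.
Proof.
rewrite /inner /mu_integralq; congr Quat; rewrite /mu_integral /Rintegral.
- by under eq_integral do rewrite (mulq_conj_real _).2.
- by under eq_integral do rewrite (mulq_conj_real _).2 /= mul0r;
    rewrite integral0.
- by under eq_integral do rewrite (mulq_conj_real _).2 /= mul0r;
    rewrite integral0.
- by under eq_integral do rewrite (mulq_conj_real _).2 /= mul0r;
    rewrite integral0.
Qed.

Lemma pf_kernel_diag_real (P : nat -> {poly quat R}) (n : nat) (x : R3) :
  pf_kernel P n x x = Quat (qre (pf_kernel P n x x)) 0 0 0.
Proof.
have real_sum (a b : quat R) : a = Quat (qre a) 0 0 0 ->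
    b = Quat (qre b) 0 0 0 -> a + b = Quat (qre (a + b)) 0 0 0.
  by move=> -> ->; congr Quat; rewrite /= addr0.
rewrite /pf_kernel; elim/big_ind: _ => // k _.
rewrite (mulq_conj_real _).1 inner_real.
by congr Quat; rewrite /=; ring.
Qed.

(* By pf_kernel_diag_real, taking the real part here only changes the type. *)
Definition density (P : nat -> {poly quat R}) (n : nat) (x : R3) : R :=
  qre (pf_kernel P n x x) * gauss x.

(* Surface integral over the sphere of radius r, in spherical coordinates:
   t.1 is the polar angle, t.2 the azimuth and r^2 sin(t.1) the area element. *)
Definition sphere_point (r : R) (t : R * R) : R3 :=
  (r * sin t.1 * cos t.2, r * sin t.1 * sin t.2, r * cos t.1).

Definition sphere_integral (r : R) (g : R3 -> R) : R :=
  Rintegral (@lebesgue_measure R \x @lebesgue_measure R)%E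
    (`[0, pi]%classic `*` `[0, 2 * pi]%classic)
    (fun t => g (sphere_point r t) * (r ^+ 2 * sin t.1)).

Definition radial_density (P : nat -> {poly quat R}) (n : nat) (r : R) : R :=
  sphere_integral r (density P n).

End PointField.

(* Main.v *)
(* On a sphere |z| = r a pure quaternion acts as r times a square root of -1, and
   the Gaussian measure has radial part x^2 exp(-x^2/2) dx. Hence the P_n have
   real coefficients and are, up to powers of this root, the orthogonal
   polynomials q_n of the weight x^2 exp(-x^2/2). As x q_n has degree n+1 and
   vanishes at 0, the radial density is the Christoffel-Darboux kernel of the
   Hermite functions on the diagonal minus a negligible rank one term.
   This diagonal is, up to averaging two consecutive indices, the energy
   a'^2 + Q a^2 of a Hermite function, where a'' = - Q a and
   Q(x) = n + 1/2 - x^2/4. Where Q > 0 the energy divided by sqrt(Q) is an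
   adiabatic invariant, so its value at 2 sqrt(n) s is the one at 0 times
   sqrt(1 - s^2), and the value at 0 is given by Wallis' formula. Where Q < 0 the
   Hermite function is positive, convex and decreasing, which forces the energy
   to be small. *)

Require Import Defs.
From HB Require Import structures.
From mathcomp Require Import all_boot all_order all_algebra.
From mathcomp Require Import all_classical all_reals all_analysis.
From mathcomp Require Import measurable_realfun.
From mathcomp Require Import ring lra zify.

Set Implicit Arguments.
Unset Strict Implicit.
Unset Printing Implicit Defensive.

Import Order.TTheory GRing.Theory Num.Theory.
Import numFieldNormedType.Exports.
Local Open Scope classical_set_scope.
Local Open Scope ring_scope.

(** * Hermite polynomials *)

(** All estimates are explicit inequalities rather than asymptotic expansions of Hermite functions.
    At 2 sqrt(n) s the adiabatic error is E(0) times O(1/n), while E(0) is of order sqrt(n). The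
    averaging over two indices is undone by monotonicity: the weighted kernel grows with its index,
    so two consecutive averages with the same limit enclose it. Noncommutativity is confined to the
    side on which coefficients stand: the Gaussian mean of z^n is real and equals, up to sign, the
    moment of index n + 2 of a formal Gaussian of variance -1. The shift by 2 is the weight factor
    x^2, and the variance -1 absorbs z^2 = -|z|^2. The constant 1/pi is (2 pi)^(-1/2), left over
    from the Gaussian density and the area of the sphere, times (2/pi)^(1/2) from Wallis. *)

Definition rising (R : pzSemiRingType) (c m : nat) : R :=
  \prod_(j < m) (c + j.*2)%:R.

Lemma rising0 (R : pzSemiRingType) c : rising R c 0 = 1.
Proof. by rewrite /rising big_ord0. Qed.

Lemma risingS (R : pzSemiRingType) c m :
  rising R c m.+1 = rising R c m * (c + m.*2)%:R.
Proof. by rewrite /rising big_ord_recr. Qed.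

Lemma risingSl (R : comPzSemiRingType) c m :
  rising R c m.+1 = c%:R * rising R c.+2 m.
Proof.
rewrite /rising big_ord_recl addn0; congr (_ * _).
by apply: eq_bigr => i _; congr (_%:R); rewrite lift0 doubleS !addnS !addSn.
Qed.

Lemma rising_gt0 (R : numDomainType) c m : (0 < c)%N -> 0 < rising R c m.
Proof. by move=> c0; apply: prodr_gt0 => i _; rewrite ltr0n addn_gt0 c0. Qed.

(** [rising R c m] is the m-th moment of a chi-squared variable with c degrees of freedom, so this
    is the moment of a sum of two independent ones. It carries Gaussian moments from dimension 1 to
    dimension 3. *)
Lemma rising_conv (R : comNzRingType) c d m :
  rising R (c + d) m =
  \sum_(j < m.+1) 'C(m, j)%:R * (rising R c (m - j) * rising R d j).
Proof.
elim: m => [|m ih].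
  by rewrite big_ord_recl big_ord0 !rising0 bin0 !mulr1 addr0.
rewrite risingS ih mulr_suml.
transitivity (\sum_(j < m.+1)
    ('C(m, j)%:R * (rising R c (m.+1 - j) * rising R d j) +
     'C(m, j)%:R * (rising R c (m - j) * rising R d j.+1))).
  apply: eq_bigr => j _.
  have jm : (j <= m)%N by rewrite -ltnS.
  rewrite subSn // !risingS.
  have -> : (c + d + m.*2 = (c + (m - j).*2) + (d + j.*2))%N by lia.
  by rewrite natrD; ring.
rewrite big_split /= [RHS]big_ord_recl /=.
have -> : \sum_(j < m.+1) 'C(m, j)%:R * (rising R c (m.+1 - j) * rising R d j) =
    \sum_(j < m.+2) 'C(m, j)%:R * (rising R c (m.+1 - j) * rising R d j).
  by rewrite [RHS]big_ord_recr /= bin_small // mul0r addr0.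
rewrite big_ord_recl /= !bin0 -addrA; congr (_ + _).
rewrite -big_split /=; apply: eq_bigr => j _.
by rewrite /bump /= !add1n binS subSS natrD; ring.
Qed.

(* [e = 1] gives the probabilists' Hermite polynomials, [e = -1] their
   rotation by i. *)
Fixpoint hermite (R : comNzRingType) (e : R) (n : nat) : {poly R} :=
  match n with
  | 0 => 1
  | n1.+1 => match n1 with
    | 0 => 'X
    | n2.+1 => 'X * hermite e n1 - e%:P * n1%:R * hermite e n2
    end
  end.

Arguments hermite : simpl never.

Section Hermite.
Variables (R : comNzRingType) (e : R).
Local Notation H := (hermite e).

Lemma hermite0 : H 0 = 1. Proof. by []. Qed.
Lemma hermite1 : H 1 = 'X. Proof. by []. Qed.

(* At [n = 0] the junk value [H 0.-1] is multiplied by 0. *)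
Lemma hermiteS n : H n.+1 = 'X * H n - e%:P * n%:R * H n.-1.
Proof. by case: n => [|n] //; rewrite mulr0 mul0r subr0 hermite0 mulr1. Qed.

Lemma deriv_hermite n : (H n)^`() = n%:R * H n.-1.
Proof.
elim/ltn_ind: n => -[|[|n]] ih.
- by rewrite hermite0 derivC mul0r.
- by rewrite hermite1 derivX mulr1.
rewrite hermiteS derivB !derivM derivX derivC -polyCMn derivC ih // ih 1?ltnW //.
rewrite polyCMn polyC1 /=; case: n ih => [|n] ih.
  by rewrite !hermite0 hermite1; ring.
by rewrite [in RHS]hermiteS [in LHS](hermiteS n.+1) /=; ring.
Qed.

End Hermite.

(** Moments of a centered Gaussian of variance e. For e = -1 they are those of i times a standard
    Gaussian, which no positive measure on the line has; hence a functional given by its moments. *)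
Definition gauss_coef (R : comNzRingType) (e : R) (i : nat) : R :=
  if odd i then 0 else e ^+ i./2 * rising R 1 i./2.

(* [e = 1] is the mean of [p] under the standard Gaussian law. *)
Definition gauss_mean (R : comNzRingType) (e : R) (p : {poly R}) : R :=
  \sum_(i < size p) p`_i * gauss_coef e i.

Section GaussMean.
Variables (R : comNzRingType) (e : R).
Local Notation H := (hermite e).
Local Notation L := (gauss_mean e).

Implicit Types p q : {poly R}.

Lemma gauss_meanE n p : (size p <= n)%N ->
  L p = \sum_(i < n) p`_i * gauss_coef e i.
Proof.
move=> pn; rewrite /gauss_mean.
rewrite -!(big_mkord xpredT (fun i => p`_i * gauss_coef e i)).
rewrite [RHS](big_cat_nat (leq0n _) pn) /=.
rewrite [X in _ = _ + X](_ : _ = 0) ?addr0 // big_nat_cond big1 // => i.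
by rewrite andbT => /andP[pi _]; rewrite nth_default // mul0r.
Qed.

Lemma gauss_meanB p q : L (p - q) = L p - L q.
Proof.
have np : (size p <= maxn (size p) (size q))%N by rewrite leq_maxl.
have nq : (size q <= maxn (size p) (size q))%N by rewrite leq_maxr.
have npq : (size (p - q)%R <= maxn (size p) (size q))%N.
  by rewrite (leq_trans (size_polyD _ _)) // size_polyN.
rewrite (gauss_meanE np) (gauss_meanE nq) (gauss_meanE npq).
by rewrite -sumrB; apply: eq_bigr => i _; rewrite coefB mulrBl.
Qed.

Lemma gauss_meanD p q : L (p + q) = L p + L q.
Proof.
have := gauss_meanB (p + q) q; rewrite addrK => ->; ring.
Qed.

Lemma gauss_meanZ a p : L (a%:P * p) = a * L p.
Proof.
rewrite [L p]/gauss_mean (@gauss_meanE (size p)) ?mul_polyC ?size_scale_leq //.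
by rewrite mulr_sumr; apply: eq_bigr => i _; rewrite coefZ mulrA.
Qed.

(** Stein's identity, which on monomials is the moment recursion m_(i+2) = e (i+1) m_i. *)
Lemma gauss_meanX p : L ('X * p) = e * L p^`().
Proof.
rewrite (@gauss_meanE (size p).+1); last first.
  by rewrite mulrC (leq_trans (size_polyMleq _ _)) // size_polyX addn2.
rewrite (@gauss_meanE (size p)); last first.
  by case: (eqVneq p 0) => [->|/lt_size_deriv /ltnW//]; rewrite deriv0 size_poly0.
rewrite big_ord_recl coefXM mul0r add0r mulr_sumr.
under eq_bigr do rewrite lift0 coefXM /=.
case: {-1}(size p) (leqnn (size p)) => [|n pn]; first by rewrite !big_ord0.
rewrite big_ord_recl [X in X + _](_ : _ = 0) ?add0r; last first.
  by rewrite /gauss_coef mulr0.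
rewrite big_ord_recr /= [X in _ = _ + X](_ : _ = 0) ?addr0; last first.
  by rewrite coef_deriv nth_default // mul0rn mul0r mulr0.
apply: eq_bigr => i _; rewrite /bump add1n coef_deriv /gauss_coef /= negbK.
case: ifP => [_|oi]; first by rewrite !mulr0.
by rewrite exprS risingS add1n halfK oi subn0 -mulr_natr; ring.
Qed.

(** By Stein's identity p -> X p - e p' is e times the adjoint of differentiation, and it sends H_n
    to H_(n+1). Orthogonality to lower powers becomes the vanishing of high derivatives. *)
Lemma hermite_adjoint n p : L (H n * p) = e ^+ n * L p^`(n).
Proof.
elim: n p => [|n ih] p; first by rewrite !mul1r.
have -> : H n.+1 * p = 'X * (H n * p) - e%:P * ((H n)^`() * p).
  by rewrite hermiteS deriv_hermite; ring.
rewrite gauss_meanB gauss_meanX gauss_meanZ derivM gauss_meanD mulrDr.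
by rewrite addrAC subrr add0r ih -derivSn exprS mulrA.
Qed.

Lemma gauss_meanC a : L a%:P = a.
Proof.
rewrite (@gauss_meanE 1) ?size_polyC_leq1 // big_ord1 coefC /gauss_coef /=.
by rewrite rising0 !mulr1.
Qed.

Lemma gauss_mean_hermiteX n j : (j <= n)%N ->
  L (H n * 'X^j) = if j == n then e ^+ n * n`!%:R else 0.
Proof.
move=> jn; rewrite hermite_adjoint derivnXn.
have [->|jn'] := eqVneq.
  by rewrite subnn ffactnn expr0 -polyCMn gauss_meanC.
rewrite ffact_small ?mulr0n; last by rewrite ltn_neqAle jn'.
by rewrite -[0]/(0%:P) gauss_meanC mulr0.
Qed.

End GaussMean.

(** * Values of Hermite polynomials and of their kernel on the diagonal *)

Section HermiteValues.
Variable R : realType.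
Implicit Types (x : R) (n : nat).

Definition herm n x : R := (hermite 1 n).[x].

Lemma herm0 x : herm 0 x = 1. Proof. by rewrite /herm hornerE. Qed.

Lemma hermS n x : herm n.+1 x = x * herm n x - n%:R * herm n.-1 x.
Proof.
rewrite /herm hermiteS mul1r hornerD hornerN -polyC1 -polyCMn !hornerM hornerX.
by rewrite hornerC.
Qed.

Lemma is_derive_herm n x : is_derive x 1 (herm n) (n%:R * herm n.-1 x).
Proof.
have := is_derive_poly (hermite 1 n) x; rewrite deriv_hermite.
by rewrite -polyC1 -polyCMn hornerM hornerC.
Qed.

(** The kernel has n terms, for the degrees below n; k! is the squared norm of the k-th Hermite
    polynomial. *)
Definition christoffel n x : R := \sum_(k < n) herm k x ^+ 2 / k`!%:R.

Lemma christoffelS n x :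
  christoffel n.+1 x = christoffel n x + herm n x ^+ 2 / n`!%:R.
Proof. by rewrite /christoffel big_ord_recr. Qed.

Lemma christoffel_ge0 n x : 0 <= christoffel n x.
Proof. by apply: sumr_ge0 => k _; rewrite divr_ge0 ?sqr_ge0. Qed.

Lemma factR_neq0 n : n`!%:R != 0 :> R.
Proof. by rewrite pnatr_eq0 -lt0n fact_gt0. Qed.

(** Confluent Christoffel-Darboux formula: [n%:R * herm n.-1 x] is the derivative H_n', so the right
    side is the quadratic form H'^2 - x H H' + n H^2. *)
Lemma christoffel_darboux n x :
  n`!%:R * christoffel n x = (n%:R * herm n.-1 x) ^+ 2
    - x * herm n x * (n%:R * herm n.-1 x) + n%:R * herm n x ^+ 2.
Proof.
elim: n => [|n ih]; first by rewrite /christoffel big_ord0; ring.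
have -> : n.+1`!%:R * christoffel n.+1 x =
    n.+1%:R * (n`!%:R * christoffel n x + herm n x ^+ 2).
  by rewrite christoffelS factS natrM; field; exact: factR_neq0.
rewrite ih hermS /=; ring.
Qed.

Lemma herm_at0 m : herm m.*2 0 = (-1) ^+ m * rising R 1 m /\ herm m.*2.+1 0 = 0.
Proof.
elim: m => [|m [ih1 ih2]]; first by rewrite herm0 hermS !mul0r rising0 mulr1 subr0.
have e : herm m.+1.*2 0 = (-1) ^+ m.+1 * rising R 1 m.+1.
  by rewrite doubleS hermS ih2 ih1 risingS add1n exprS /=; ring.
by split=> //; rewrite hermS e doubleS /= ih2; ring.
Qed.

Lemma fact_double m : m.*2`!%:R = rising R 1 m * rising R 2 m.
Proof.
elim: m => [|m ih]; first by rewrite !rising0 mulr1.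
by rewrite doubleS !factS !natrM ih !risingS add1n add2n; ring.
Qed.

(** Odd terms vanish at 0, and the even ones (2j-1)!!/(2j)!! have partial sums (2m+1)!!/(2m)!!, the
    ratio estimated by Wallis. *)
Lemma christoffel_at0 m :
  christoffel m.*2.+1 0 = rising R 3 m / rising R 2 m /\
  christoffel m.*2.+2 0 = rising R 3 m / rising R 2 m.
Proof.
suff e : christoffel m.*2.+1 0 = rising R 3 m / rising R 2 m.
  by split=> //; rewrite christoffelS e (herm_at0 m).2 expr0n mul0r addr0.
elim: m => [|m ih].
  by rewrite christoffelS /christoffel big_ord0 herm0 !rising0 fact0; field.
have r0 c k : rising R c.+1 k != 0 by rewrite gt_eqF // rising_gt0.
rewrite doubleS 2!christoffelS ih (herm_at0 m).2 -doubleS (herm_at0 m.+1).1.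
rewrite fact_double risingSl mul1r !risingS exprMn sqrr_sign expr0n mul0r addr0.
have n0 : 2%:R + m.*2%:R != 0 :> R by rewrite -natrD pnatr_eq0.
rewrite !natrD; field.
by rewrite n0 !r0.
Qed.

End HermiteValues.

(** * The Hermite oscillator *)

(* [a'' = - Q a]: the equation of the Hermite functions.  For [x >= 0] its
   energy is nonincreasing, and up to a small correction it is proportional to
   [sqrt Q] as long as [Q] varies slowly (adiabatic invariance). *)
Section Oscillator.
Variables (R : realType) (kappa : R) (a b : R -> R).

Definition potential (x : R) := kappa - x ^+ 2 / 4.
Definition energy (x : R) := b x ^+ 2 + potential x * a x ^+ 2.

Local Notation Q := potential.
Local Notation E := energy.

Hypothesis a' : forall x : R, is_derive x 1 a (b x).
Hypothesis b' : forall x : R, is_derive x 1 b (- Q x * a x).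

Lemma is_derive_potential (x : R) : is_derive x 1 Q (- x / 2).
Proof. by rewrite /Q; apply: is_derive_eq; rewrite /GRing.scale /=; field. Qed.
Local Existing Instance is_derive_potential.

Lemma is_derive_energy (x : R) : is_derive x 1 E (- x / 2 * a x ^+ 2).
Proof. by rewrite /E; apply: is_derive_eq; rewrite /GRing.scale /=; field. Qed.

Lemma energy_nincr (x y : R) : 0 <= x -> x <= y -> E y <= E x.
Proof.
move=> x0; rewrite le_eqVlt => /predU1P[->//|xy].
have [||c] := @MVT R E (fun x => - x / 2 * a x ^+ 2) x y xy.
- by move=> z _; exact: is_derive_energy.
- apply: derivable_within_continuous => z _.
  exact: (@ex_derive _ _ _ _ _ _ _ (is_derive_energy z)).
rewrite in_itv /= => /andP[xc _] e; rewrite -subr_le0 e mulr_le0_ge0 //.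
  by rewrite mulr_le0_ge0 ?sqr_ge0 //; lra.
by rewrite subr_ge0 ltW.
Qed.

Lemma is_derive_sqrt_potential (x : R) : 0 < Q x ->
  is_derive x 1 (fun y => Num.sqrt (Q y)) (- x / (4 * Num.sqrt (Q x))).
Proof.
move=> Qx; have s0 : Num.sqrt (Q x) != 0 by rewrite gt_eqF // sqrtr_gt0.
have -> : - x / (4 * Num.sqrt (Q x)) = (2 * Num.sqrt (Q x))^-1 * (- x / 2).
  by field.
by apply: (@is_derive1_comp _ Num.sqrt Q); exact: is_derive1_sqrt.
Qed.

(** With X of order sqrt(n) and Q X of order n, the bound is E 0 times O(1/n). *)
Lemma adiabatic_invariance (X : R) : 0 < X -> 0 < Q X ->
  `|E X - Num.sqrt (Q X / kappa) * E 0| <=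
  E 0 / (2 * Num.sqrt (Q X)) * (X / (2 * Q X) + 3 * X ^+ 3 / (16 * Q X ^+ 2)).
Proof.
move=> X0 qX.
pose s (y : R) : R := Num.sqrt (Q y).
have Qge (x : R) : 0 <= x -> x <= X -> Q X <= Q x.
  move=> x0 xX; rewrite lerD2l lerN2 ler_pM2r // ler_pXn2r // nnegrE //.
  exact: ltW.
have Qgt0 (x : R) : 0 <= x -> x <= X -> 0 < Q x.
  by move=> x0 xX; exact: lt_le_trans (Qge _ x0 xX).
have s2 (x : R) : 0 <= x -> x <= X -> Q x = s x ^+ 2.
  by move=> x0 xX; rewrite sqr_sqrtr // ltW // Qgt0.
have sgt0 (x : R) : 0 <= x -> x <= X -> 0 < s x by move=> *; rewrite sqrtr_gt0 Qgt0.
have sge (x : R) : 0 <= x -> x <= X -> s X <= s x.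
  by move=> x0 xX; apply: ler_wsqrtr; exact: Qge.
(* 2 s |a b| <= b^2 + s^2 a^2 = E <= E 0, and s is smallest at X. *)
have ab (x : R) : 0 <= x -> x <= X -> `|a x * b x| <= E 0 / (2 * s X).
  move=> x0 xX; have sx := sgt0 _ x0 xX; have sX := sgt0 _ (ltW X0) (lexx X).
  rewrite ler_pdivlMr ?mulr_gt0 // normrM.
  apply: le_trans (energy_nincr (lexx 0) x0).
  rewrite /E (s2 _ x0 xX) -(ger0_norm (sqr_ge0 (b x))) -(ger0_norm (sqr_ge0 (a x))).
  rewrite !normrX; have := sqr_ge0 (`|b x| - s x * `|a x|).
  have : `|a x| * `|b x| * s X <= `|a x| * `|b x| * s x.
    by rewrite ler_wpM2l ?mulr_ge0 ?sge.
  by move=> h1 h2; nra.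
(* [E / s] has derivative [x / (4 s^3) * (a b)']; subtracting the product
   removes the oscillating term and leaves one of smaller order. *)
pose G (x : R) : R := E x / s x - x / (4 * s x ^+ 3) * (a x * b x).
pose dG (x : R) : R := - (1 / (4 * s x ^+ 3) + 3 * x ^+ 2 / (16 * s x ^+ 5)) * (a x * b x).
have G' (x : R) : 0 <= x -> x <= X -> is_derive x 1 G (dG x).
  move=> x0 xX; have sx := sgt0 _ x0 xX.
  have ? := is_derive_sqrt_potential (Qgt0 _ x0 xX).
  have ? := is_derive_energy x.
  have sx0 : s x != 0 by rewrite gt_eqF.
  have s3 : 4 * s x ^+ 3 != 0 by rewrite mulf_neq0 // expf_neq0.
  rewrite /G; apply: is_derive_eq; rewrite /GRing.scale /= /dG /E -/(s x).
  rewrite (s2 _ x0 xX).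
  by field; rewrite sx0.
have [||c cX GX] := @MVT R G dG 0 X X0.
- by move=> x; rewrite in_itv /= => /andP[x0 xX]; apply: G'; exact: ltW.
- apply: derivable_within_continuous => x; rewrite in_itv /= => /andP[x0 xX].
  exact: (@ex_derive _ _ _ _ _ _ _ (G' x x0 xX)).
move: cX; rewrite in_itv /= => /andP[/ltW c0 /ltW cX].
have sX := sgt0 _ (ltW X0) (lexx X).
have sX0 : s X != 0 by rewrite gt_eqF.
have s00 : s 0 != 0 by rewrite gt_eqF // sgt0 // ltW.
have -> : Num.sqrt (Q X / kappa) = s X / s 0.
  have Q0 : Q 0 = kappa by rewrite /Q expr0n mul0r subr0.
  by rewrite sqrtrM ?ltW // sqrtrV -Q0 // ltW // Qgt0 // ltW.
(* The mean value identity for G times s X; the subtracted product vanishes at 0 because of its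
   factor x. *)
have -> : E X - s X / s 0 * E 0 =
    s X * (dG c * X) + X / (4 * s X ^+ 2) * (a X * b X).
  move: GX; rewrite subr0 /G !mul0r subr0 => <-.
  by field; rewrite sX0.
rewrite -/(s X) (s2 _ (ltW X0) (lexx X)).
apply: (@le_trans _ _ (s X * ((1 / (4 * s X ^+ 3) + 3 * X ^+ 2 / (16 * s X ^+ 5))
    * (E 0 / (2 * s X)) * X) + X / (4 * s X ^+ 2) * (E 0 / (2 * s X)))); last first.
  by rewrite le_eqVlt; apply/orP; left; apply/eqP; field.
have sc := sgt0 _ c0 cX.
(* Used for the denominators 4 s^3 and 16 s^5. *)
have V (k m : nat) : (m.+1%:R * s c ^+ k)^-1 <= (m.+1%:R * s X ^+ k)^-1.
  rewrite lef_pV2 ?posrE ?mulr_gt0 ?exprn_gt0 // ler_wpM2l //.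
  by rewrite lerXn2r ?sge // nnegrE ltW.
apply: (le_trans (ler_normD _ _)); apply: lerD.
  have -> : `|s X * (dG c * X)| = s X * (`|1 / (4 * s c ^+ 3) +
      3 * c ^+ 2 / (16 * s c ^+ 5)| * `|a c * b c| * X).
    by rewrite /dG !normrM normrN (gtr0_norm sX) (gtr0_norm X0).
  rewrite ler_wpM2l ?(ltW sX) // ler_wpM2r ?(ltW X0) // ler_pM ?ab //.
  rewrite ger0_norm; last first.
    by rewrite addr_ge0 // ?divr_ge0 ?mulr_ge0 ?sqr_ge0 ?exprn_ge0 ?(ltW sc).
  apply: lerD; first by rewrite !mul1r; exact: (V 3 3).
  apply: ler_pM; last exact: (V 5 15).
  - by rewrite mulr_ge0 ?sqr_ge0.
  - by rewrite invr_ge0 mulr_ge0 ?exprn_ge0 ?(ltW sc).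
  - by rewrite ler_wpM2l // lerXn2r // nnegrE ltW.
have ? : 0 <= X / (4 * s X ^+ 2) by rewrite divr_ge0 ?mulr_ge0 ?sqr_ge0 ?ltW.
by rewrite normrM (@ger0_norm _ (X / _)) // ler_wpM2l // ab // ltW.
Qed.

(* [a] is convex and nonincreasing there, so [- b x] is at most the absolute
   slope of a chord of [a] ending at [x]. *)
Lemma forbidden_region (y x : R) : y < x ->
  (forall t, y <= t -> t <= x -> [/\ Q t <= 0, 0 <= a t & b t <= 0]) ->
  E x <= (a y / (x - y)) ^+ 2.
Proof.
move=> yx H; have ad (z : R) : derivable a z 1 by exact: (@ex_derive _ _ _ _ _ _ _ (a' z)).
have bd (z : R) : derivable b z 1 by exact: (@ex_derive _ _ _ _ _ _ _ (b' z)).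
have [|c cyx eac] := @MVT R a b y x yx (fun z _ => a' z).
  by apply: derivable_within_continuous => z _; exact: ad.
move: cyx; rewrite in_itv /= => /andP[yc cx].
have [|d dcx ebd] := @MVT R b (fun z => - Q z * a z) c x cx (fun z _ => b' z).
  by apply: derivable_within_continuous => z _; exact: bd.
move: dcx; rewrite in_itv /= => /andP[cd dx].
have [Qd ad0 _] := H d (ltW (lt_trans yc cd)) (ltW dx).
have [Qx ax0 bx0] := H x (ltW yx) (lexx _).
have bcx : b c <= b x by rewrite -subr_ge0 ebd; apply: mulr_ge0; nra.
have bx : - b x <= a y / (x - y).
  by rewrite ler_pdivlMr ?subr_gt0 //; nra.
by rewrite /E -[b x ^+ 2]sqrrN; nra.
Qed.

End Oscillator.

(** * Hermite functions as solutions of the oscillator equation *)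

Section HermiteFunctions.
Variable R : realType.
Implicit Types (x : R) (n : nat).

Definition weighted_christoffel n x : R :=
  expR (- x ^+ 2 / 2) * christoffel n x.
Local Notation F := weighted_christoffel.

Definition hermite_fun n x : R :=
  herm n x * expR (- x ^+ 2 / 4) / Num.sqrt n`!%:R.

Definition hermite_fun' n x : R :=
  (n%:R * herm n.-1 x - x / 2 * herm n x) * expR (- x ^+ 2 / 4)
  / Num.sqrt n`!%:R.

Let sqrt_fact_neq0 n : Num.sqrt n`!%:R != 0 :> R.
Proof. by rewrite gt_eqF // sqrtr_gt0 ltr0n fact_gt0. Qed.

Local Existing Instance is_derive_herm.

Lemma is_derive_gauss x :
  is_derive x 1 (fun y : R => expR (- y ^+ 2 / 4)) (- x / 2 * expR (- x ^+ 2 / 4)).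
Proof.
have -> : - x / 2 * expR (- x ^+ 2 / 4) = expR (- x ^+ 2 / 4) * (- x / 2).
  by ring.
apply: (@is_derive1_comp _ expR (fun y : R => - y ^+ 2 / 4)).
by apply: is_derive_eq; rewrite /GRing.scale /=; field.
Qed.
Local Existing Instance is_derive_gauss.

Lemma is_derive_hermite_fun n x :
  is_derive x 1 (hermite_fun n) (hermite_fun' n x).
Proof.
rewrite /hermite_fun; apply: is_derive_eq.
by rewrite /GRing.scale /= /hermite_fun'; field.
Qed.

Lemma is_derive_hermite_fun' n x :
  is_derive x 1 (hermite_fun' n)
    (- potential (n%:R + 2^-1) x * hermite_fun n x).
Proof.
rewrite /hermite_fun'; apply: is_derive_eq.
rewrite /GRing.scale /= /hermite_fun /potential.
case: n => [|n] /=; first by rewrite herm0; field; exact: sqrt_fact_neq0.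
have e : n%:R * herm n.-1 x = x * herm n x - herm n.+1 x by rewrite hermS; ring.
by rewrite e; field; exact: sqrt_fact_neq0.
Qed.

(** Up to the Gaussian factor and n!, b^2 = (H' - x H / 2)^2; adding (n - x^2/4) H^2 gives the
    Christoffel-Darboux form, and the 1/2 in kappa adds half of the next term of the kernel. *)
Lemma energy_hermite n x :
  energy (n%:R + 2^-1) (hermite_fun n) (hermite_fun' n) x =
  (F n x + F n.+1 x) / 2.
Proof.
have e2 : expR (- x ^+ 2 / 2) = expR (- x ^+ 2 / 4) ^+ 2.
  by rewrite -expRM_natl; congr expR; field.
have s2 : Num.sqrt n`!%:R ^+ 2 = n`!%:R :> R by rewrite sqr_sqrtr.
have s0 := sqrt_fact_neq0 n.
have -> : F n x = expR (- x ^+ 2 / 2) * ((n`!%:R * christoffel n x) / n`!%:R).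
  by rewrite /F; field; exact: factR_neq0.
have -> : F n.+1 x = expR (- x ^+ 2 / 2) *
    ((n`!%:R * christoffel n x) / n`!%:R + herm n x ^+ 2 / n`!%:R).
  by rewrite /F christoffelS; field; exact: factR_neq0.
rewrite christoffel_darboux e2 -s2.
by rewrite /energy /potential /hermite_fun /hermite_fun'; field.
Qed.

Lemma hermite_fun_sqr n x : hermite_fun n x ^+ 2 = F n.+1 x - F n x.
Proof.
rewrite /F christoffelS /hermite_fun.
rewrite -mulrBr addrAC subrr add0r expr_div_n exprMn -expRM_natl.
rewrite sqr_sqrtr //.
have -> : expR (2 * (- x ^+ 2 / 4)) = expR (- x ^+ 2 / 2) by congr expR; field.
by rewrite mulrCA mulrA.
Qed.

Lemma weighted_christoffel_le n x : 0 <= F n x <= F n.+1 x.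
Proof.
rewrite mulr_ge0 ?expR_ge0 ?christoffel_ge0 //=.
by rewrite -subr_ge0 -hermite_fun_sqr sqr_ge0.
Qed.

Lemma weighted_christoffel_at0 n : F n 0 = christoffel n 0.
Proof. by rewrite /F expr0n /= oppr0 mul0r expR0 mul1r. Qed.

(** The energy is an average of F n and F n.+1, hence at least F n at x and at most F n.+1 at 0, and
    it decreases in between. *)
Lemma weighted_christoffel_bound n x : 0 <= x -> F n x <= christoffel n.+1 0.
Proof.
move=> x0; have := energy_nincr (is_derive_hermite_fun n) (is_derive_hermite_fun' n) (lexx 0) x0.
rewrite !energy_hermite -!weighted_christoffel_at0.
have /andP[_ ?] := weighted_christoffel_le n x.
have /andP[_ ?] := weighted_christoffel_le n 0.
lra.
Qed.

(** The ratio bound H_(n+1)/H_n >= x/2 reproduces itself in the recursion as long as the coefficient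
    stays below x^2/4: x/2 is the double root of t^2 - x t + x^2/4. It also says that the Hermite
    function is nonincreasing at x. *)
Lemma herm_forbidden n x : 4 * n%:R <= x ^+ 2 -> 0 < x ->
  0 < herm n x /\ x / 2 * herm n x <= herm n.+1 x.
Proof.
move=> + x0; elim: n => [|n ih] nx.
  by rewrite herm0 hermS herm0 /=; split=> //; lra.
have [h0 h1] : 0 < herm n x /\ x / 2 * herm n x <= herm n.+1 x.
  by apply: ih; apply: le_trans nx; rewrite ler_pM2l // ler_nat.
have h2 : 0 < herm n.+1 x by apply: lt_le_trans h1; rewrite mulr_gt0 // divr_gt0.
split=> //; rewrite (hermS n.+1) /=.
have : n.+1%:R * herm n x <= x ^+ 2 / 4 * herm n x.
  by rewrite ler_wpM2r ?(ltW h0) //; lra.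
have : x / 2 * (x / 2 * herm n x) <= x / 2 * herm n.+1 x.
  by rewrite ler_wpM2l // divr_ge0 ?ltW.
lra.
Qed.

(** The chord bound involves a(y)^2, which is a difference of weighted kernels and so at most F n.+1
    y. *)
Lemma weighted_christoffel_forbidden n (y x : R) : 0 < y -> y < x ->
  4 * n.+1%:R <= y ^+ 2 -> F n x <= christoffel n.+2 0 / (x - y) ^+ 2.
Proof.
move=> y0 yx ny.
have /andP[_ Fle] := weighted_christoffel_le n x.
have FE : F n x <= energy (n%:R + 2^-1) (hermite_fun n) (hermite_fun' n) x.
  by rewrite energy_hermite; lra.
apply: (le_trans FE).
have H t : y <= t -> t <= x -> [/\ potential (n%:R + 2^-1) t <= 0,
    0 <= hermite_fun n t & hermite_fun' n t <= 0].
  move=> yt tx.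
  have t0 : 0 < t by exact: lt_le_trans yt.
  have nt : 4 * n.+1%:R <= t ^+ 2 by nra.
  have nt' : 4 * n%:R <= t ^+ 2.
    by apply: le_trans nt; rewrite ler_pM2l // ler_nat.
  have [h0 h1] := herm_forbidden nt' t0.
  split.
  - by rewrite /potential; move: nt; rewrite -(natr1 n); lra.
  - by rewrite /hermite_fun divr_ge0 ?mulr_ge0 ?expR_ge0 ?sqrtr_ge0 ?ltW.
  - rewrite /hermite_fun' mulr_le0_ge0 ?invr_ge0 ?sqrtr_ge0 //.
    rewrite mulr_le0_ge0 ?expR_ge0 //.
    by move: h1; rewrite hermS; lra.
apply: (le_trans (forbidden_region (is_derive_hermite_fun n) (is_derive_hermite_fun' n) yx H)).
rewrite expr_div_n ler_wpM2r ?invr_ge0 ?sqr_ge0 // hermite_fun_sqr.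
have /andP[? _] := weighted_christoffel_le n y.
have := weighted_christoffel_bound n.+1 (ltW y0); lra.
Qed.

End HermiteFunctions.

(** * Gaussian moments and Wallis' formula *)

Section GaussianMoments.
Variable R : realType.
Local Notation mu := (@lebesgue_measure R).
Implicit Types (x b : R) (k n : nat).

Definition gauss_weight x : R := expR (- x ^+ 2 / 2).
Local Notation w := gauss_weight.

Lemma is_derive_gauss_weight x : is_derive x 1 w (- x * w x).
Proof.
rewrite (_ : - x * w x = w x * - x); last by rewrite mulrC.
apply: (@is_derive1_comp _ expR (fun y : R => - y ^+ 2 / 2)).
by apply: is_derive_eq; rewrite /GRing.scale /=; field.
Qed.
Local Existing Instance is_derive_gauss_weight.

Lemma continuous_gauss_weight : continuous w.
Proof.
move=> x; apply: differentiable_continuous; apply/derivable1_diffP.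
exact: (@ex_derive _ _ _ _ _ _ _ (is_derive_gauss_weight x)).
Qed.

Lemma derivable_LRcontinuous (f df : R -> R) (a b : R) :
  (forall x, is_derive x 1 f (df x)) -> derivable_oo_LRcontinuous f a b.
Proof.
move=> f'; have df1 x : derivable f x 1 by exact: (@ex_derive _ _ _ _ _ _ _ (f' x)).
have cf x : {for x, continuous f}.
  by apply: differentiable_continuous; apply/derivable1_diffP.
split; first by move=> x _.
  by apply: cvg_at_right_filter; exact: cf.
by apply: cvg_at_left_filter; exact: cf.
Qed.

Lemma continuous_moment k : continuous (fun x : R => x ^+ k * w x).
Proof.
by move=> x; apply: cvgM; [exact: exprn_continuous | exact: continuous_gauss_weight].
Qed.

Lemma continuous_abs_moment k : continuous (fun x : R => `|x| ^+ k * w x).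
Proof.
move=> x; apply: cvgM; last exact: continuous_gauss_weight.
apply: (@continuous_comp _ _ _ (@Num.norm R R) (fun y : R => y ^+ k)).
  exact: norm_continuous.
exact: exprn_continuous.
Qed.

(** Integration by parts with x w = (- w)'; the boundary term at b is kept, to be sent to 0
    afterwards. *)
Lemma segment_moment k b : 0 < b ->
  (\int[mu]_(x in `[0, b]) (x ^+ k.+2 * w x))%R =
  k.+1%:R * (\int[mu]_(x in `[0, b]) (x ^+ k * w x))%R - b ^+ k.+1 * w b.
Proof.
move=> b0.
have F' x : is_derive x 1 (fun x : R => x ^+ k.+1) (k.+1%:R * x ^+ k).
  by apply: DeriveDef; [exact: exprn_derivable | rewrite exp_derive /GRing.scale /= mulr1].
have G' x : is_derive x 1 (fun x : R => - w x) (x * w x).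
  by apply: is_derive_eq; rewrite mulNr opprK.
have cw : continuous w := continuous_gauss_weight.
have cX j : continuous (fun x : R => x ^+ j) by move=> x; exact: exprn_continuous.
have ik : mu.-integrable `[0, b] (EFin \o (fun x : R => x ^+ k * w x)).
  apply: continuous_compact_integrable; first exact: segment_compact.
  exact/continuous_subspaceT/continuous_moment.
have parts := @Rintegration_by_parts R (fun x => x ^+ k.+1) (fun x => - w x)
  (fun x => k.+1%:R * x ^+ k) (fun x => x * w x) 0 b b0.
under [in LHS]eq_Rintegral do rewrite exprSr -mulrA.
rewrite parts //; last 6 first.
- apply: continuous_subspaceT => x.
  by apply: cvgM; [exact: cvg_cst | exact: cX].
- exact: derivable_LRcontinuous F'.
- by move=> x _; rewrite derive1E; exact: derive_val.
- by apply: continuous_subspaceT => x; apply: cvgM; [exact: cvg_id | exact: cw].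
- exact: derivable_LRcontinuous G'.
- by move=> x _; rewrite derive1E; exact: derive_val.
rewrite !expr0n !mul0r subr0 mulrN.
under eq_Rintegral do rewrite mulrN -mulrA -mulNr.
by rewrite RintegralZl // mulNr opprK addrC.
Qed.

Lemma cvg_moment_boundary k : n%:R ^+ k * w n%:R @[n --> \oo] --> (0 : R).
Proof.
rewrite -cvg_shiftS /=.
(* With y = n^2/2, the bound expR y >= y^(k+1)/(k+1)! reads C * expR y >= n^(2k+2), which exceeds
   n^k * n. *)
pose C : R := 2 ^+ k.+1 * k.+1`!%:R.
apply: (@squeeze_cvgr _ _ _ _ (fun=> 0) (fun n => C * harmonic n)); last 2 first.
- exact: cvg_cst.
- by rewrite -(mulr0 C); apply: cvgM; [exact: cvg_cst | exact: cvg_harmonic].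
near=> n; rewrite mulr_ge0 ?expR_ge0 //=.
have n1 : 1 <= n.+1%:R :> R by rewrite ler1n.
have n0 : 0 < n.+1%:R :> R by [].
have y0 : 0 <= n.+1%:R ^+ 2 / 2 :> R by rewrite divr_ge0 ?sqr_ge0.
rewrite /w mulNr expRN ler_pdivrMr ?expR_gt0 // mulrAC ler_pdivlMr //.
apply: (@le_trans _ _ (C * ((n.+1%:R ^+ 2 / 2) ^+ k.+1 / k.+1`!%:R))); last first.
  rewrite ler_wpM2l ?mulr_ge0 ?exprn_ge0 //.
  by apply: le_trans (expR_ge1Dxn k y0); rewrite lerDr.
rewrite /C expr_div_n.
have -> : 2 ^+ k.+1 * k.+1`!%:R * ((n.+1%:R ^+ 2) ^+ k.+1 / 2 ^+ k.+1 / k.+1`!%:R) =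
    (n.+1%:R ^+ 2) ^+ k.+1 :> R.
  by field; rewrite factR_neq0 expf_neq0.
by rewrite -exprSr -exprM mulnC muln2 ler_weXn2l // -addnn leq_addr.
Unshelve. all: by end_near. Qed.

Definition half_moment k : R :=
  if odd k then rising R 2 k./2 else rising R 1 k./2 * Num.sqrt (pi / 2).

Lemma half_momentSS k : half_moment k.+2 = k.+1%:R * half_moment k.
Proof.
rewrite /half_moment /= negbK; have := odd_double_half k.
case: (odd k) => e; rewrite risingS.
  have -> : (k.+1 = 2 + k./2.*2)%N by rewrite -{1}e.
  by rewrite mulrC.
have -> : (k.+1 = 1 + k./2.*2)%N by rewrite -{1}e.
by ring.
Qed.

(** The absolute value changes nothing on the half-line, but makes the integrand nonnegative
    everywhere, so that integrals over [0, n] converge to this one. The normal law gives k = 0, a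
    primitive gives k = 1, and the recursion on [0, n] passes to the limit. *)
Lemma integral_half_moment k :
  (\int[mu]_(x in `[0%R, +oo[) (`|x| ^+ k * w x)%:E)%E = (half_moment k)%:E.
Proof.
have w0 x : 0 <= w x by exact: expR_ge0.
have cvgI j := @ge0_cvgn_integral R mu (fun x : R => `|x| ^+ j * w x)
  (fun x => mulr_ge0 (exprn_ge0 _ (normr_ge0 x)) (w0 x))
  (continuous_measurable_fun (@continuous_abs_moment j)).
pose I j n := (\int[mu]_(x in `[0%R, n%:R]) (x ^+ j * w x))%R.
have IE j n : (\int[mu]_(x in `[0%R, n%:R]) (`|x| ^+ j * w x)%:E)%E = (I j n)%:E.
  rewrite /I /Rintegral fineK.
    apply: eq_integral => x; rewrite inE /= in_itv /= => /andP[x0 _].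
    by rewrite ger0_norm.
  apply: integrable_fin_num => //.
  apply: continuous_compact_integrable; first exact: segment_compact.
  exact/continuous_subspaceT/continuous_moment.
have cvgIE j : (I j n)%:E @[n --> \oo] -->
    (\int[mu]_(x in `[0%R, +oo[) (`|x| ^+ j * w x)%:E)%E.
  by under eq_cvg do rewrite -IE; exact: cvgI.
elim/ltn_ind: k => -[|[|k]] ih.
- have pdfE x : normal_pdf 0 1 x = (Num.sqrt (pi *+ 2))^-1 * w x.
    rewrite normal_pdfE ?oner_neq0 // /normal_peak /normal_fun.
    by rewrite expr1n mul1r subr0.
  have := @integral_normal_pdf R 0 1.
  rewrite ge0_symfun_integralT; last 3 first.
  - by move=> x; exact: normal_pdf_ge0.
  - exact/continuous_normal_pdf/oner_neq0.
  - by move=> x /=; rewrite !pdfE /w sqrrN.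
  under eq_integral do rewrite pdfE EFinM.
  rewrite -set_itvcy ge0_integralZl //=; last 2 first.
  - apply: measurableT_comp => //; apply: measurable_funTS.
    exact: continuous_measurable_fun continuous_gauss_weight.
  - by move=> x _; rewrite lee_fin.
  under [in X in _ -> X]eq_integral do rewrite expr0 mul1r.
  set N := (\int[mu]_(x in _) _)%E => e.
  pose c : R := Num.sqrt (pi *+ 2).
  have c0 : c != 0 by rewrite gt_eqF // sqrtr_gt0 pmulrn_lgt0 ?pi_gt0.
  have -> : N = ((c / 2)%:E * (2%:E * (c^-1%:E * N)))%E.
    by rewrite !muleA -!EFinM (_ : c / 2 * 2 * c^-1 = 1) ?mul1e //; field.
  rewrite e mule1 /half_moment /= rising0 mul1r; congr EFin.
  have -> : c / 2 = Num.sqrt (pi *+ 2) / Num.sqrt 4.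
    by rewrite (_ : 4 = 2 ^+ 2) ?sqrtr_sqr ?ger0_norm //; ring.
  have p2 : 0 <= pi *+ 2 :> R by rewrite pmulrn_lge0 ?pi_ge0.
  by rewrite -sqrtrV // -sqrtrM //; congr (Num.sqrt _); field.
- transitivity (\int[mu]_(x in `[0%R, +oo[) (x * w x)%:E)%E.
    apply: eq_integral => x; rewrite inE /= in_itv /= andbT => x0.
    by rewrite ger0_norm // expr1.
  rewrite (@ge0_continuous_FTC2y R _ (fun x => - w x) 0 0).
  + by rewrite /w expr0n oppr0 mul0r expR0 -EFinB sub0r opprK /half_moment /= rising0.
  + by move=> x x0; rewrite mulr_ge0.
  + apply: continuous_subspaceT => x.
    by apply: cvgM; [exact: cvg_id | exact: continuous_gauss_weight].
  + rewrite -oppr0; apply: cvgN.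
    apply: (@squeeze_cvgr _ _ _ _ (fun=> 0) (fun x : R => expR (- x))); last 2 first.
    * exact: cvg_cst.
    * exact: cvgr_expR.
    near=> x; rewrite w0 /= ler_expR.
    have : 2 <= x by near: x; exact: nbhs_pinfty_ge.
    by move=> ?; nra.
  + move=> x _; exact: (@ex_derive _ _ _ _ _ _ _ (is_deriveN (is_derive_gauss_weight x))).
  + by apply: cvg_at_right_filter; apply: cvgN; exact: continuous_gauss_weight.
  + move=> x _; rewrite derive1E; apply: derive_val.
    by apply: is_derive_eq; rewrite mulNr opprK.
have := cvgIE k; rewrite ih //.
move=> /fine_cvgP[_] /= cI.
have cI2 : I k.+2 n @[n --> \oo] --> half_moment k.+2.
  rewrite -cvg_shiftS /=.
  under eq_cvg do rewrite /I segment_moment //.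
  rewrite half_momentSS -[_ * _]subr0.
  apply: cvgB.
    apply: cvgM; first exact: cvg_cst.
    by rewrite (cvg_shiftS (I k)).
  by rewrite (cvg_shiftS (fun n => n%:R ^+ k.+1 * w n%:R)); exact: cvg_moment_boundary.
have := cvgIE k.+2.
move=> /cvg_unique; apply => //.
by apply: cvg_EFin; [exact: nearW | exact: cI2].
Unshelve. all: by end_near. Qed.

End GaussianMoments.

(** * Wallis' formula from log-convexity of moments *)

Section Wallis.
Variable R : realType.
Local Notation mu := (@lebesgue_measure R).
Local Notation w := (@gauss_weight R).
Local Notation h := (half_moment R).
Implicit Types (x : R) (k m n N : nat).

Lemma half_moment_gt0 k : 0 < h k.
Proof.
rewrite /half_moment; case: ifP => _; rewrite ?mulr_gt0 ?rising_gt0 //.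
by rewrite sqrtr_gt0 divr_gt0 ?pi_gt0.
Qed.

Lemma integrable_half_moment k :
  mu.-integrable `[0, +oo[ (EFin \o (fun x => x ^+ k * w x)).
Proof.
apply/integrableP; split.
  apply: measurableT_comp => //; apply: measurable_funTS.
  exact: continuous_measurable_fun (@continuous_moment R k).
rewrite (_ : (\int[mu]_(x in _) _)%E = (h k)%:E) ?ltry //.
rewrite -integral_half_moment; apply: eq_integral => x _ /=.
by rewrite normrM normrX (ger0_norm (expR_ge0 _)).
Qed.

Lemma Rintegral_half_moment k : (\int[mu]_(x in `[0%R, +oo[) (x ^+ k * w x))%R = h k.
Proof.
rewrite /Rintegral -[h k]/(fine (h k)%:E) -integral_half_moment; congr fine.
apply: eq_integral => x; rewrite inE /= in_itv /= andbT => x0.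
by rewrite ger0_norm.
Qed.

(* Cauchy-Schwarz: the quadratic form [t |-> int x^k (x - t)^2] is
   nonnegative. *)
Lemma half_moment_log_convex k : h k.+1 ^+ 2 <= h k * h k.+2.
Proof.
(* The minimiser of the quadratic form. *)
pose t := h k.+1 / h k.
have h0 := half_moment_gt0 k.
have I j := integrable_half_moment j.
have IZ (c : R) j : mu.-integrable `[0, +oo[ (EFin \o (fun x => c * (x ^+ j * w x))).
  exact: (integrableZl _ c (I j)).
have : 0 <= (\int[mu]_(x in `[0%R, +oo[)
   ((x ^+ k.+2 * w x - (2 * t) * (x ^+ k.+1 * w x)) + t ^+ 2 * (x ^+ k * w x)))%R.
  apply: Rintegral_ge0 => x /=; rewrite in_itv /= andbT => x0.
  have -> : x ^+ k.+2 * w x - 2 * t * (x ^+ k.+1 * w x) + t ^+ 2 * (x ^+ k * w x) =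
     x ^+ k * w x * (x - t) ^+ 2 by rewrite !exprS; ring.
  by rewrite mulr_ge0 ?sqr_ge0 // mulr_ge0 ?exprn_ge0 ?expR_ge0.
rewrite RintegralD //; last first.
  exact: (integrableB _ (I k.+2) (IZ _ _)).
rewrite RintegralB // !RintegralZl // !Rintegral_half_moment.
have -> : h k.+2 - 2 * t * h k.+1 + t ^+ 2 * h k = h k.+2 - h k.+1 ^+ 2 / h k.
  by rewrite /t; field; rewrite gt_eqF.
by rewrite subr_ge0 ler_pdivrMr // mulrC.
Qed.

(** Log-convexity at k and k.+1, once the recursion eliminates the moments k.+2 and k.+3, confines
    (h k.+1 / h k)^2 between (k+1)^2/(k+2) and k+1. *)
Lemma half_moment_ratio k :
  h k.+1 ^+ 2 <= k.+1%:R * h k ^+ 2 /\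
  k.+1%:R ^+ 2 * h k ^+ 2 <= k.+2%:R * h k.+1 ^+ 2.
Proof.
have := half_moment_log_convex k; have := half_moment_log_convex k.+1.
rewrite !half_momentSS => h1 h2; split.
  by apply: le_trans h2 _; rewrite le_eqVlt; apply/orP; left; apply/eqP; ring.
rewrite -exprMn; apply: le_trans h1 _.
by rewrite le_eqVlt; apply/orP; left; apply/eqP; ring.
Qed.

Lemma wallis_odd m :
  2 / pi * m.*2.+1%:R <= (christoffel m.*2.+1 (0 : R)) ^+ 2 <= 2 / pi * m.*2.+2%:R.
Proof.
have pi0 : (pi : R) != 0 by rewrite gt_eqF ?pi_gt0.
have h0 := half_moment_gt0 m.*2; have h1 := half_moment_gt0 m.*2.+1.
have hE : h m.*2 ^+ 2 = rising R 1 m ^+ 2 * (pi / 2).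
  rewrite /half_moment odd_double doubleK exprMn sqr_sqrtr //.
  by rewrite divr_ge0 ?pi_ge0.
have hO : h m.*2.+1 = rising R 2 m.
  by rewrite /half_moment /= odd_double uphalf_double.
have r1 : rising R 1 m != 0 by rewrite gt_eqF ?rising_gt0.
have r2 : rising R 2 m != 0 by rewrite gt_eqF ?rising_gt0.
have -> : christoffel m.*2.+1 (0 : R) ^+ 2 =
    2 / pi * (m.*2.+1%:R ^+ 2 * h m.*2 ^+ 2) / h m.*2.+1 ^+ 2.
  rewrite (christoffel_at0 _ _).1 hE hO.
  have -> : rising R 3 m = rising R 1 m * m.*2.+1%:R.
    by have := risingSl R 1 m; rewrite mul1r => <-; rewrite risingS add1n.
  by move: pi0; move: (pi : R) => p p0; field; rewrite r2 p0.
have [a b] := half_moment_ratio m.*2.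
have p0 : 0 <= 2 / pi :> R by rewrite divr_ge0 ?pi_ge0.
move: p0; move: (2 / pi : R) => p p0.
rewrite ler_pdivlMr ?exprn_gt0 // ler_pdivrMr ?exprn_gt0 // -!mulrA.
apply/andP; split; apply: ler_wpM2l => //; first exact: ler_wpM2l.
by rewrite mulrA -expr2.
Qed.

(** The interval is wider than in [wallis_odd] so as to cover both parities. *)
Lemma wallis N : 2 / pi * N%:R <= (christoffel N.+1 (0 : R)) ^+ 2 <= 2 / pi * N.+2%:R.
Proof.
have p0 : 0 <= 2 / pi :> R by rewrite divr_ge0 ?pi_ge0.
have := odd_double_half N; case: (odd N) => <-; set m := N./2.
  rewrite add1n (christoffel_at0 _ _).2 -(christoffel_at0 _ _).1.
  have /andP[-> /le_trans ->] //= := wallis_odd m.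
  by rewrite ler_wpM2l // ler_nat.
rewrite add0n; have /andP[h1 ->] := wallis_odd m; rewrite andbT.
by apply: le_trans h1; rewrite ler_wpM2l // ler_nat.
Qed.

End Wallis.

(** * Asymptotics of the Hermite kernel *)

Section Asymptotics.
Variable R : realType.
Local Notation F := (@weighted_christoffel R).
Implicit Types (s : R) (k n : nat).

(** Index 0 is dropped because the identities to come divide by n or by sqrt(n). *)
Lemma cvg_eventually_eq (u v : nat -> R) (l : R) :
  (forall n, u n.+1 = v n.+1) -> v n @[n --> \oo] --> l -> u n @[n --> \oo] --> l.
Proof.
move=> uv; rewrite -cvg_shiftS -[X in _ -> X]cvg_shiftS /=.
by under eq_cvg do rewrite -uv.
Qed.

Lemma cvg_invn : (n%:R : R)^-1 @[n --> \oo] --> (0 : R).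
Proof. by rewrite -cvg_shiftS; exact: cvg_harmonic. Qed.

Lemma cvg_christoffel_at0 k :
  christoffel (n + k).+1 0 / Num.sqrt n%:R @[n --> \oo] --> Num.sqrt (2 / pi : R).
Proof.
have ge0 n : 0 <= christoffel (n + k).+1 (0 : R) / Num.sqrt n%:R.
  by rewrite divr_ge0 ?christoffel_ge0 ?sqrtr_ge0.
pose u n := (christoffel (n + k).+1 (0 : R) / Num.sqrt n%:R) ^+ 2.
suff cu : u n @[n --> \oo] --> (2 / pi : R).
  have -> : (fun n => christoffel (n + k).+1 0 / Num.sqrt n%:R) =
      Num.sqrt \o u by apply/funext => n; rewrite /= sqrtr_sqr ger0_norm.
  exact: (cvg_comp _ _ cu (@sqrt_continuous _ _)).
rewrite -cvg_shiftS /=.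
pose bnd j n : R := 2 / pi * (1 + j%:R * harmonic n).
have cbnd j : bnd j n @[n --> \oo] --> (2 / pi : R).
  have -> : 2 / pi = 2 / pi * (1 + j%:R * 0) :> R by rewrite mulr0 addr0 mulr1.
  apply: cvgM; first exact: cvg_cst.
  apply: cvgD; first exact: cvg_cst.
  by apply: cvgM; [exact: cvg_cst | exact: cvg_harmonic].
apply: (@squeeze_cvgr _ _ _ _ (bnd k) (bnd k.+2)); [|exact: cbnd..].
near=> n; have /andP[h1 h2] := wallis R (n.+1 + k).
have n0 : 0 < n.+1%:R :> R by [].
rewrite /u expr_div_n sqr_sqrtr // ler_pdivlMr // ler_pdivrMr // /bnd /harmonic.
have bE j : 2 / pi * (1 + j%:R * n.+1%:R^-1) * n.+1%:R = 2 / pi * (n.+1 + j)%:R :> R.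
  by rewrite natrD -[LHS]mulrA [X in _ * X]mulrDl mul1r divfK ?gt_eqF.
by rewrite !bE h1 !addnS.
Unshelve. all: by end_near. Qed.

Lemma cvg_energy_bulk s k : 0 < s -> s < 1 ->
  (F (n + k).+1 (2 * Num.sqrt n%:R * s) + F (n + k).+2 (2 * Num.sqrt n%:R * s))
    / 2 / Num.sqrt n%:R @[n --> \oo] --> Num.sqrt (2 / pi : R) * Num.sqrt (1 - s ^+ 2).
Proof.
move=> s0 s1.
pose A n := (F (n + k).+1 (2 * Num.sqrt n%:R * s)
  + F (n + k).+2 (2 * Num.sqrt n%:R * s)) / 2 / Num.sqrt n%:R.
pose B n : R := (christoffel (n + k).+1 0 / Num.sqrt n%:R
  + christoffel (n + k.+1).+1 0 / Num.sqrt n%:R) / 2.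
have cB : B n @[n --> \oo] --> Num.sqrt (2 / pi : R).
  rewrite [X in _ --> X](_ : _ = (Num.sqrt (2 / pi) + Num.sqrt (2 / pi)) / 2); last by field.
  apply: cvgM; last exact: cvg_cst.
  by apply: cvgD; exact: cvg_christoffel_at0.
(* At x = 2 sqrt(n) s the potential is at least n d. *)
pose d := 1 - s ^+ 2.
have d0 : 0 < d by rewrite /d; nra.
pose kap n : R := (n + k).+1%:R + 2^-1.
pose q n : R := Num.sqrt ((kap n - n%:R * s ^+ 2) / kap n).
have cq : q n @[n --> \oo] --> Num.sqrt d.
  apply: (@cvg_comp _ _ _ (fun n => (kap n - n%:R * s ^+ 2) / kap n) Num.sqrt);
    last exact: sqrt_continuous.
  pose c : R := k.+1%:R + 2^-1.
  have cc : 1 + c * n%:R^-1 @[n --> \oo] --> (1 + c * 0 : R).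
    apply: cvgD; first exact: cvg_cst.
    by apply: cvgM; [exact: cvg_cst | exact: cvg_invn].
  apply: (@cvg_eventually_eq _
      (fun n => (1 + c * n%:R^-1 - s ^+ 2) / (1 + c * n%:R^-1))).
    move=> n; have n0 : n.+1%:R != 0 :> R by [].
    have -> : kap n.+1 = n.+1%:R * (1 + c * n.+1%:R^-1).
      by rewrite mulrDr mulr1 mulrCA mulfV // mulr1 /kap /c -addnS natrD addrA.
    by rewrite -mulrBr -mulf_div divff // mul1r.
  rewrite [X in _ --> X](_ : _ = (1 + c * 0 - s ^+ 2) / (1 + c * 0)); last first.
    by rewrite mulr0 addr0 divr1.
  apply: cvgM; first by apply: cvgB; [exact: cc | exact: cvg_cst].
  by apply: cvgV => //; rewrite mulr0 addr0 oner_neq0.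
(* C / n is the factor of E 0 in the adiabatic bound at X = 2 sqrt(n) s, with Q X replaced by n
   d. *)
pose C := (2 * Num.sqrt d)^-1 * (s / d + 3 * s ^+ 3 / (2 * d ^+ 2)).
pose e n : R := B n * (C * n%:R^-1).
have ce : e n @[n --> \oo] --> (0 : R).
  rewrite [X in _ --> X](_ : _ = Num.sqrt (2 / pi) * (C * 0)); last by rewrite !mulr0.
  apply: cvgM; first exact: cB.
  by apply: cvgM; [exact: cvg_cst | exact: cvg_invn].
have H : \forall n \near \oo, `|A n - q n * B n| <= e n.
  near=> n.
  have n0 : 0 < n%:R :> R by near: n; exact: nbhs_infty_gtr.
  have sn0 : 0 < Num.sqrt n%:R :> R by rewrite sqrtr_gt0.
  have sn2 : Num.sqrt n%:R ^+ 2 = n%:R :> R by rewrite sqr_sqrtr.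
  pose x := 2 * Num.sqrt n%:R * s.
  have x0 : 0 < x by rewrite !mulr_gt0.
  have QE : potential (kap n) x = kap n - n%:R * s ^+ 2.
    by rewrite /potential /x !exprMn sn2; field.
  have nd : n%:R * d <= potential (kap n) x.
    by rewrite QE /kap /d -addnS natrD; have : 0 <= k.+1%:R :> R by []; lra.
  have Q0 : 0 < potential (kap n) x by apply: lt_le_trans nd; rewrite mulr_gt0.
  have := adiabatic_invariance (is_derive_hermite_fun (n + k).+1)
    (is_derive_hermite_fun' (n + k).+1) x0 Q0.
  rewrite !energy_hermite !weighted_christoffel_at0 -/(kap n) QE -/(q n).
  rewrite -QE; set V := (_ + _) / 2; set W := (_ + _) / 2.
  set D := potential _ _ in nd Q0 *; move=> VW.
  have W0 : 0 <= W by rewrite divr_ge0 ?addr_ge0 ?christoffel_ge0.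
  have -> : A n - q n * B n = (V - q n * W) / Num.sqrt n%:R.
    by rewrite /A /B -/x -/V addnS -mulrDl mulrBl; congr (_ - _); rewrite /W; ring.
  rewrite normrM (@ger0_norm _ (_^-1)) ?invr_ge0 ?sqrtr_ge0 //.
  have -> : e n = W * (C * n%:R^-1) / Num.sqrt n%:R.
    by rewrite /e /B addnS -mulrDl /W; ring.
  rewrite ler_wpM2r ?invr_ge0 ?sqrtr_ge0 //; apply: (le_trans VW).
  rewrite -mulrA ler_wpM2l //.
  have nd0 : 0 < n%:R * d by rewrite mulr_gt0.
  have -> : C * n%:R^-1 = (2 * Num.sqrt (n%:R * d))^-1 *
      (x / (2 * (n%:R * d)) + 3 * x ^+ 3 / (16 * (n%:R * d) ^+ 2)).
    (* Here m, r, g stand for sqrt(n), sqrt(d), d: writing n as m^2 leaves a rational identity. *)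
    have key (m r g : R) : m != 0 -> r != 0 -> g != 0 ->
        (2 * r)^-1 * (s / g + 3 * s ^+ 3 / (2 * g ^+ 2)) / m ^+ 2 =
        (2 * (m * r))^-1 * (2 * m * s / (2 * (m ^+ 2 * g)) +
           3 * (2 * m * s) ^+ 3 / (16 * (m ^+ 2 * g) ^+ 2)).
      by move=> m0 r0 g0; field; rewrite m0 r0 g0.
    have sd0 : Num.sqrt d != 0 by rewrite gt_eqF // sqrtr_gt0.
    have := key (Num.sqrt n%:R) (Num.sqrt d) d (lt0r_neq0 sn0) sd0 (lt0r_neq0 d0).
    rewrite sn2 sqrtrM //.
  apply: ler_pM.
  - by rewrite invr_ge0 mulr_ge0 ?sqrtr_ge0.
  - by rewrite addr_ge0 ?divr_ge0 ?mulr_ge0 ?exprn_ge0 ?(ltW s0) ?(ltW Q0).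
  - by rewrite lef_pV2 ?posrE ?mulr_gt0 ?sqrtr_gt0 // ler_pM2l // ler_wsqrtr.
  apply: lerD.
    by rewrite ler_wpM2l ?(ltW x0) // lef_pV2 ?posrE ?mulr_gt0 // ler_pM2l.
  rewrite ler_wpM2l ?mulr_ge0 ?exprn_ge0 ?(ltW s0) //.
  rewrite lef_pV2 ?posrE ?mulr_gt0 ?exprn_gt0 // ler_pM2l //.
  by rewrite lerXn2r // nnegrE ltW.
apply: (@squeeze_cvgr _ _ _ _ (fun n => q n * B n - e n) (fun n => q n * B n + e n)).
- by near=> n; rewrite -ler_distl; near: n.
- rewrite [X in _ --> X](_ : _ = Num.sqrt d * Num.sqrt (2 / pi) - 0); last by rewrite subr0 mulrC.
  by apply: cvgB ce; apply: cvgM.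
- rewrite [X in _ --> X](_ : _ = Num.sqrt d * Num.sqrt (2 / pi) + 0); last by rewrite addr0 mulrC.
  by apply: cvgD ce; apply: cvgM.
Unshelve. all: by end_near. Qed.

Lemma cvg_weighted_christoffel_bulk s : 0 < s -> s < 1 ->
  F n.+2 (2 * Num.sqrt n%:R * s) / Num.sqrt n%:R @[n --> \oo] -->
  Num.sqrt (2 / pi : R) * Num.sqrt (1 - s ^+ 2).
Proof.
move=> s0 s1.
(* F n.+2 lies between its average with F n.+1 and its average with F n.+3. *)
apply: (squeeze_cvgr _ (cvg_energy_bulk 0 s0 s1) (cvg_energy_bulk 1 s0 s1)).
near=> n; rewrite addn0 addn1.
set x := 2 * _ * s.
have /andP[_ h1] := weighted_christoffel_le n.+1 x.
have /andP[_ h2] := weighted_christoffel_le n.+2 x.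
by rewrite !ler_wpM2r ?invr_ge0 ?sqrtr_ge0 //; lra.
Unshelve. all: by end_near. Qed.

Lemma cvg_weighted_christoffel_outer s : 1 < s ->
  F n.+2 (2 * Num.sqrt n%:R * s) / Num.sqrt n%:R @[n --> \oo] --> (0 : R).
Proof.
(* 2 sqrt(n) t is beyond the turning point for large n, yet at distance of order sqrt(n) from x: the
   chord bound gains a factor 1/n. *)
move=> s1; have [t t1 ts] : exists2 t : R, 1 < t & t < s by exists ((1 + s) / 2); lra.
pose C := (4 * (s - t) ^+ 2)^-1.
apply: (@squeeze_cvgr _ _ _ _ (fun=> 0) (fun n => christoffel (n + 3).+1 0
    / Num.sqrt n%:R * (C * n%:R^-1))); last 2 first.
- exact: cvg_cst.
- rewrite [X in _ --> X](_ : 0 = Num.sqrt (2 / pi) * (C * 0)); last by rewrite !mulr0.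
  apply: cvgM; first exact: cvg_christoffel_at0.
  by apply: cvgM; [exact: cvg_cst | exact: cvg_invn].
near=> n.
have n0 : 0 < n%:R :> R by near: n; exact: nbhs_infty_gtr.
(* Equivalent to n + 3 <= n t^2, the forbidden-region condition for index n.+2. *)
have nt : 3 / (t ^+ 2 - 1) <= n%:R by near: n; exact: nbhs_infty_ger.
have sn0 : 0 < Num.sqrt n%:R :> R by rewrite sqrtr_gt0.
have sn2 : Num.sqrt n%:R ^+ 2 = n%:R :> R by rewrite sqr_sqrtr.
rewrite divr_ge0 ?sqrtr_ge0 //=; last by have /andP[] := weighted_christoffel_le n.+2 (2 * Num.sqrt n%:R * s).
rewrite [leRHS]mulrAC ler_wpM2r ?invr_ge0 ?sqrtr_ge0 //.
have yx : 2 * Num.sqrt n%:R * t < 2 * Num.sqrt n%:R * s.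
  by rewrite ltr_pM2l ?mulr_gt0.
have y0 : 0 < 2 * Num.sqrt n%:R * t by rewrite !mulr_gt0 //; lra.
have yn : 4 * n.+3%:R <= (2 * Num.sqrt n%:R * t) ^+ 2.
  rewrite !exprMn sn2; move: nt; rewrite ler_pdivrMr; last by nra.
  have -> : n.+3%:R = n%:R + 3 :> R by rewrite -natrD addn3.
  lra.
apply: le_trans (weighted_christoffel_forbidden y0 yx yn) _.
rewrite addn3 -mulrBr exprMn exprMn sn2.
have -> : 2 ^+ 2 * n%:R * (s - t) ^+ 2 = 4 * (s - t) ^+ 2 * n%:R by ring.
by rewrite invfM.
Unshelve. all: by end_near. Qed.

(** The numerator is bounded by a kernel value at 0, of order sqrt(n), so the division by x^2 leaves
    O(1/n). *)
Lemma cvg_weighted_christoffel_correction s (M : nat -> nat) :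
  0 < s -> (forall n, (M n <= n.+2)%N) ->
  (F (M n).+1 (2 * Num.sqrt n%:R * s) - F (M n) (2 * Num.sqrt n%:R * s))
    / (2 * Num.sqrt n%:R * s) ^+ 2 / Num.sqrt n%:R @[n --> \oo] --> (0 : R).
Proof.
move=> s0 Mn.
have mono m p : (m <= p)%N -> christoffel m (0 : R) <= christoffel p 0.
  move=> /subnK <-; elim: (p - m)%N => [|q ih]; first by rewrite add0n.
  by apply: le_trans ih _; rewrite addSn christoffelS lerDl divr_ge0 ?sqr_ge0.
pose C := (4 * s ^+ 2)^-1.
apply: (@squeeze_cvgr _ _ _ _ (fun=> 0) (fun n => christoffel (n + 3).+1 0
    / Num.sqrt n%:R * (C * n%:R^-1))); last 2 first.
- exact: cvg_cst.
- rewrite [X in _ --> X](_ : 0 = Num.sqrt (2 / pi) * (C * 0)); last by rewrite !mulr0.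
  apply: cvgM; first exact: cvg_christoffel_at0.
  by apply: cvgM; [exact: cvg_cst | exact: cvg_invn].
near=> n; set x := 2 * _ * s.
have x0 : 0 <= x by rewrite !mulr_ge0 ?sqrtr_ge0 ?(ltW s0).
have /andP[F0 F1] := weighted_christoffel_le (M n) x.
apply/andP; split.
  by rewrite !divr_ge0 ?sqrtr_ge0 ?sqr_ge0 // subr_ge0.
rewrite [leRHS]mulrAC ler_wpM2r ?invr_ge0 ?sqrtr_ge0 //.
have -> : C * n%:R^-1 = (x ^+ 2)^-1.
  by rewrite /C /x !exprMn sqr_sqrtr // -invfM; congr (_^-1); ring.
rewrite ler_wpM2r ?invr_ge0 ?sqr_ge0 //.
have := weighted_christoffel_bound (M n).+1 x0.
have : christoffel (M n).+2 (0 : R) <= christoffel (n + 3).+1 0.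
  by apply: mono; rewrite addn3 !ltnS.
lra.
Unshelve. all: by end_near. Qed.

End Asymptotics.

(** * Gaussian means on R^3 *)

Lemma integrable_prod (d1 d2 : measure_display) (T1 : measurableType d1)
    (T2 : measurableType d2) (R : realType)
    (m1 : {sigma_finite_measure set T1 -> \bar R})
    (m2 : {sigma_finite_measure set T2 -> \bar R}) (f : T1 -> R) (g : T2 -> R) :
  m1.-integrable setT (EFin \o f) -> m2.-integrable setT (EFin \o g) ->
  (m1 \x m2)%E.-integrable setT (EFin \o (fun z => f z.1 * g z.2)) /\
  (\int[(m1 \x m2)%E]_z (f z.1 * g z.2) = (\int[m1]_x f x) * (\int[m2]_y g y))%R.
Proof.
move=> If Ig.
have mf : measurable_fun setT f by apply/measurable_EFinP; exact: measurable_int If.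
have mg : measurable_fun setT g by apply/measurable_EFinP; exact: measurable_int Ig.
have mfg : measurable_fun setT (fun z : T1 * T2 => f z.1 * g z.2).
  by apply: measurable_funM; exact: measurableT_comp.
have mEf : measurable_fun setT (fun x => `|f x|%:E).
  by apply/measurable_EFinP; exact: measurableT_comp.
have mEg : measurable_fun setT (fun y => `|g y|%:E).
  by apply/measurable_EFinP; exact: measurableT_comp.
have abs_fg x : (\int[m2]_y `|(f x * g y)%:E| = `|f x|%:E * \int[m2]_y `|g y|%:E)%E.
  rewrite -ge0_integralZl //.
  by apply: eq_integral => y _; rewrite /= normrM EFinM.
have Ifg : (m1 \x m2)%E.-integrable setT (EFin \o (fun z => f z.1 * g z.2)).
  apply/integrable12ltyP; first exact/measurable_EFinP.
  rewrite (eq_integral _ _ (fun x _ => abs_fg x)).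
  have /integrableP[_ fy] := If.
  have /integrableP[_ gy] := Ig.
  rewrite ge0_integralZr //; last exact: integral_ge0.
  rewrite lte_mul_pinfty //; first exact: integral_ge0.
  by rewrite ge0_fin_numE // integral_ge0.
split=> //.
rewrite /Rintegral -integral12_prod_meas1 // /fubini_F.
have fin_f : (\int[m1]_x (f x)%:E)%E \is a fin_num by exact: integrable_fin_num.
have fin_g : (\int[m2]_y (g y)%:E)%E \is a fin_num by exact: integrable_fin_num.
rewrite -fineM // -(fineK fin_g) -integralZr //; congr fine.
apply: eq_integral => x _; rewrite fineK // -integralZl //.
Qed.

Section LebesgueSpace.
Variable R : realType.
Local Notation mu := (@lebesgue_measure R).

(* For a product measure, canonical inference finds the structure of products
   of sub-probabilities first; this alias carries the sigma-finite one. *)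
Definition lebesgue2 : set (measurableTypeR R * measurableTypeR R)%type -> \bar R :=
  (@lebesgue_measure R \x @lebesgue_measure R)%E.

HB.instance Definition _ := Measure.on lebesgue2.

Let lebesgue2_sigma_finite : sigma_finite setT lebesgue2.
Proof.
by have [] := lebesgue_integral_fubini.measure_function_Measure_isSigmaFinite__to__measure_function_isSigmaFinite mu mu.
Qed.

HB.instance Definition _ := Measure_isSigmaFinite.Build _ _ _ lebesgue2
  lebesgue2_sigma_finite.

Lemma integrable_lebesgue3 (f g h : R -> R) :
  mu.-integrable setT (EFin \o f) -> mu.-integrable setT (EFin \o g) ->
  mu.-integrable setT (EFin \o h) ->
  (@lebesgue3 R).-integrable setT (EFin \o (fun z => f z.1.1 * g z.1.2 * h z.2)) /\
  Rintegral (@lebesgue3 R) setT (fun z => f z.1.1 * g z.1.2 * h z.2) =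
  (\int[mu]_x f x) * (\int[mu]_x g x) * (\int[mu]_x h x).
Proof.
move=> If Ig Ih.
have [I1 <-] := integrable_prod If Ig.
exact: (@integrable_prod _ _ _ _ R lebesgue2 mu _ _ I1 Ih).
Qed.
End LebesgueSpace.

Section GaussianSpace.
Variable R : realType.
Local Notation mu := (@lebesgue_measure R).
Local Notation w := (@gauss_weight R).

Lemma integral_abs_moment k :
  (\int[mu]_x (`|x| ^+ k * w x)%:E)%E = (2 * half_moment R k)%:E.
Proof.
rewrite ge0_symfun_integralT.
- by rewrite -set_itvcy integral_half_moment.
- by move=> x; rewrite mulr_ge0 ?expR_ge0 ?exprn_ge0.
- exact: continuous_abs_moment.
- by move=> x /=; rewrite normrN /gauss_weight sqrrN.
Qed.

Lemma integrable_moment k : mu.-integrable setT (EFin \o (fun x => x ^+ k * w x)).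
Proof.
apply/integrableP; split.
  apply: measurableT_comp => //.
  exact: continuous_measurable_fun (@continuous_moment R k).
rewrite (_ : (\int[mu]_x _)%E = (2 * half_moment R k)%:E) ?ltry //.
rewrite -integral_abs_moment; apply: eq_integral => x _ /=.
by rewrite normrM normrX (ger0_norm (expR_ge0 _)).
Qed.

Lemma integral_moment k :
  \int[mu]_x (x ^+ k * w x) = Num.sqrt (2 * pi) * gauss_coef 1 k.
Proof.
rewrite /gauss_coef; case: ifPn => ok; last first.
  rewrite expr1n mul1r /Rintegral.
  transitivity (fine (\int[mu]_x (`|x| ^+ k * w x)%:E)%E).
    congr fine; apply: eq_integral => x _; congr (_ * _)%:E.
    by rewrite -normrX ger0_norm // exprn_even_ge0.
  rewrite integral_abs_moment /half_moment (negbTE ok) /=.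
  have -> : Num.sqrt (2 * pi) = 2 * Num.sqrt (pi / 2) :> R.
    rewrite (_ : 2 * pi = 2 ^+ 2 * (pi / 2)); last by field.
    by rewrite sqrtrM ?sqr_ge0 // sqrtr_sqr ger0_norm.
  by ring.
(* For odd k the two half-lines cancel. *)
have -> : [set: R] = `]-oo, 0[ `|` `[0, +oo[.
  by rewrite -setCitvr setUC setUv.
have Iabs : mu.-integrable setT (EFin \o (fun x => `|x| ^+ k * w x)).
  apply/integrableP; split.
    apply: measurableT_comp => //.
    exact: continuous_measurable_fun (@continuous_abs_moment R k).
  rewrite (_ : (\int[mu]_x _)%E = (2 * half_moment R k)%:E) ?ltry //.
  rewrite -integral_abs_moment; apply: eq_integral => x _ /=.
  by rewrite ger0_norm // mulr_ge0 ?expR_ge0 ?exprn_ge0.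
rewrite Rintegral_setU //; last 2 first.
- by rewrite -setCitvr setvU; exact: integrable_moment.
- by apply/disj_setPS => x [] /=; rewrite !in_itv /= andbT => /lt_geF ->.
rewrite Rintegral_half_moment mulr0.
have -> : \int[mu]_(x in `]-oo, 0[) (x ^+ k * w x) =
    \int[mu]_(x in `]-oo, 0[) ((-1) * (`|x| ^+ k * w x)).
  apply: eq_Rintegral => x; rewrite inE /= in_itv /= => x0.
  by rewrite ltr0_norm // exprNn -signr_odd ok expr1 !mulN1r mulNr opprK.
rewrite RintegralZl //; last exact: integrableS Iabs.
rewrite Rintegral_itv_bndo_bndc; last exact: integrableS Iabs.
rewrite /Rintegral -{1}oppr0 ge0_integration_by_substitutionNy.
- under eq_integral do rewrite /= normrN /gauss_weight sqrrN.
  by rewrite integral_half_moment /= mulN1r addNr.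
- exact/continuous_subspaceT/continuous_abs_moment.
- by move=> x _; rewrite mulr_ge0 ?expR_ge0 ?exprn_ge0.
Qed.

Definition gauss_cst : R := (Num.sqrt (2 * pi))^-1.

Lemma powR_gauss_cst : (2 * pi) `^ (- (3 / 2)) = gauss_cst ^+ 3.
Proof.
rewrite powRN /gauss_cst exprVn; congr (_^-1).
rewrite -powR12_sqrt ?mulr_ge0 ?pi_ge0 // -powR_mulrn ?powR_ge0 // -powRrM.
by congr (_ `^ _); field.
Qed.

Lemma gauss_factor (z : R3 R) :
  gauss z = gauss_cst ^+ 3 * (w z.1.1 * w z.1.2 * w z.2).
Proof.
rewrite /gauss /gauss_weight -!expRD powR_gauss_cst; congr (_ * expR _).
by rewrite /sqnormq /pureq /= expr0n /= add0r; field.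
Qed.

(** Integrability travels with the value because linearity of the integral requires it. *)
Definition has_gauss_mean (g : R3 R -> R) (v : R) :=
  (@lebesgue3 R).-integrable setT (EFin \o (fun z => g z * gauss z)) /\
  mu_integral g = v.

Lemma has_gauss_mean_eq f g v : f =1 g -> has_gauss_mean f v -> has_gauss_mean g v.
Proof. by move=> /funext ->. Qed.

Lemma has_gauss_mean_monomial a b c :
  has_gauss_mean (fun z => z.1.1 ^+ a * z.1.2 ^+ b * z.2 ^+ c)
    (gauss_coef 1 a * gauss_coef 1 b * gauss_coef 1 c).
Proof.
have [I E] := integrable_lebesgue3 (integrable_moment a) (integrable_moment b)
  (integrable_moment c).
have gE : (fun z : R3 R => z.1.1 ^+ a * z.1.2 ^+ b * z.2 ^+ c * gauss z) =
    (fun z => gauss_cst ^+ 3 * (z.1.1 ^+ a * w z.1.1 * (z.1.2 ^+ b * w z.1.2) *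
      (z.2 ^+ c * w z.2))).
  by apply/funext => z; rewrite gauss_factor; ring.
rewrite /has_gauss_mean /mu_integral gE; split.
  exact: (integrableZl _ _ I).
rewrite RintegralZl // E !integral_moment /gauss_cst.
have p0 : Num.sqrt (2 * pi) != 0 :> R by rewrite gt_eqF // sqrtr_gt0 mulr_gt0 ?pi_gt0.
by move: p0; move: (Num.sqrt _) => p p0; field.
Qed.

Lemma has_gauss_meanD f g u v : has_gauss_mean f u -> has_gauss_mean g v ->
  has_gauss_mean (fun z => f z + g z) (u + v).
Proof.
move=> [If <-] [Ig <-]; rewrite /has_gauss_mean /mu_integral.
have -> : (fun z => (f z + g z) * gauss z) = (fun z => f z * gauss z + g z * gauss z).
  by apply/funext => z; rewrite mulrDl.
split; last by rewrite RintegralD.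
exact: (integrableD _ If Ig).
Qed.

Lemma has_gauss_meanZ c f u : has_gauss_mean f u ->
  has_gauss_mean (fun z => c * f z) (c * u).
Proof.
move=> [If <-]; rewrite /has_gauss_mean /mu_integral.
have -> : (fun z => c * f z * gauss z) = (fun z => c * (f z * gauss z)).
  by apply/funext => z; rewrite mulrA.
split; last by rewrite RintegralZl.
exact: (integrableZl _ _ If).
Qed.

Lemma has_gauss_mean0 : has_gauss_mean (fun=> 0) 0.
Proof.
have := has_gauss_meanZ 0 (has_gauss_mean_monomial 0 0 0); rewrite mul0r.
by apply: has_gauss_mean_eq => z; rewrite mul0r.
Qed.

Lemma has_gauss_mean_sum (I : Type) (r : seq I) (f : I -> R3 R -> R) (u : I -> R) :
  (forall i, has_gauss_mean (f i) (u i)) ->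
  has_gauss_mean (fun z => \sum_(i <- r) f i z) (\sum_(i <- r) u i).
Proof.
move=> fu; elim: r => [|i r ih].
  rewrite big_nil; apply: has_gauss_mean_eq has_gauss_mean0.
  by move=> z; rewrite big_nil.
rewrite big_cons; apply: has_gauss_mean_eq (has_gauss_meanD (fu i) ih).
by move=> z; rewrite big_cons.
Qed.

End GaussianSpace.

(** * Real scalars, conjugation and norm in the quaternions *)

Section QuaternionReal.
Variable R : realFieldType.
Implicit Types (a b : R) (q : quat R).

Definition quat_real a : quat R := Quat a 0 0 0.

Lemma quat_real_is_zmod_morphism : zmod_morphism quat_real.
Proof. by move=> a b; congr Quat; rewrite /= subr0. Qed.

Lemma quat_real_is_monoid_morphism : monoid_morphism quat_real.
Proof. by split=> // a b; congr Quat; rewrite /=; ring. Qed.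

HB.instance Definition _ := GRing.isZmodMorphism.Build R (quat R) quat_real
  quat_real_is_zmod_morphism.
HB.instance Definition _ := GRing.isMonoidMorphism.Build R (quat R) quat_real
  quat_real_is_monoid_morphism.

Lemma quat_realC a q : quat_real a * q = q * quat_real a.
Proof. by congr Quat; rewrite /=; ring. Qed.

Lemma conjq_zmod_morphism : zmod_morphism (@conjq R).
Proof. by move=> p q; congr Quat; rewrite /=; ring. Qed.

HB.instance Definition _ := GRing.isZmodMorphism.Build (quat R) (quat R) (@conjq R)
  conjq_zmod_morphism.

Lemma conjqM p q : conjq (p * q) = conjq q * conjq p.
Proof. by congr Quat; rewrite /=; ring. Qed.

Lemma conjq1 : conjq 1 = 1 :> quat R.
Proof. by congr Quat; rewrite /= oppr0. Qed.

Lemma conjq_real a : conjq (quat_real a) = quat_real a.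
Proof. by congr Quat; rewrite /= oppr0. Qed.

Lemma conjqX q n : conjq (q ^+ n) = conjq q ^+ n.
Proof.
by elim: n => [|n ih]; rewrite ?expr0 ?conjq1 // exprS conjqM ih -exprSr.
Qed.

Lemma sqnormqM p q : sqnormq (p * q) = sqnormq p * sqnormq q.
Proof. by rewrite /sqnormq /=; ring. Qed.

Lemma sqnormq_real a : sqnormq (quat_real a) = a ^+ 2.
Proof. by rewrite /sqnormq /= !expr0n /= !addr0. Qed.

End QuaternionReal.

(** The trinomial is nested so that taking means of squares yields [rising_conv] twice, for 1 + 1
    and 2 + 1 degrees of freedom. *)
Lemma expr_sum3 (K : comNzRingType) (x y t : K) m a b c :
  \sum_(j < m.+1) 'C(m, j)%:R * (\sum_(i < (m - j).+1)
    'C(m - j, i)%:R * (x ^+ ((m - j - i).*2 + a) * y ^+ (i.*2 + b) * t ^+ (j.*2 + c))) =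
  (x ^+ 2 + y ^+ 2 + t ^+ 2) ^+ m * (x ^+ a * y ^+ b * t ^+ c).
Proof.
rewrite exprDn mulr_suml; apply eq_bigr => j _.
rewrite -[X in _ = X * _]mulr_natl -[RHS]mulrA; congr (_ * _); rewrite exprDn.
rewrite !mulr_suml; apply eq_bigr => i _.
by rewrite -[X in _ = X * _ * _]mulr_natl !exprD -!mul2n !exprM; ring.
Qed.

Section QuaternionMean.
Variable R : realType.
Local Notation qr := (@quat_real R).
Local Notation gc := (@gauss_coef R).
Implicit Types (z : R3 R).

Lemma sqr_pureq z : pureq z ^+ 2 = qr (- sqnormq (pureq z)).
Proof. by congr Quat; rewrite /= /sqnormq /=; ring. Qed.

Lemma conjq_pureq z : conjq (pureq z) = - pureq z.
Proof.
rewrite -[RHS]/(Quat (- 0) (- _) (- _) (- _)) oppr0.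
by [].
Qed.

Lemma pureq_expE z m :
  pureq z ^+ m.*2 = qr ((-1) ^+ m * sqnormq (pureq z) ^+ m) /\
  pureq z ^+ m.*2.+1 = qr ((-1) ^+ m * sqnormq (pureq z) ^+ m) * pureq z.
Proof.
suff e : pureq z ^+ m.*2 = qr ((-1) ^+ m * sqnormq (pureq z) ^+ m).
  by split=> //; rewrite exprSr e.
by rewrite -mul2n exprM sqr_pureq -rmorphXn; congr (qr _); exact: exprNn.
Qed.

Lemma gauss_coef_double m : gc 1 m.*2 = rising R 1 m.
Proof. by rewrite /gauss_coef odd_double doubleK expr1n mul1r. Qed.

Lemma has_gauss_mean_norm m a b c :
  has_gauss_mean (fun z => sqnormq (pureq z) ^+ m * (z.1.1 ^+ a * z.1.2 ^+ b * z.2 ^+ c))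
    (\sum_(j < m.+1) 'C(m, j)%:R * \sum_(i < (m - j).+1) 'C(m - j, i)%:R *
      (gc 1 ((m - j - i).*2 + a) * gc 1 (i.*2 + b) * gc 1 (j.*2 + c))).
Proof.
have H := has_gauss_mean_sum (index_enum 'I_m.+1)
  (fun j => has_gauss_meanZ 'C(m, j)%:R
    (has_gauss_mean_sum (index_enum 'I_(m - j).+1)
      (fun i => has_gauss_meanZ 'C(m - j, i)%:R
    (has_gauss_mean_monomial R ((m - j - i).*2 + a) (i.*2 + b) (j.*2 + c))))).
apply: has_gauss_mean_eq H => z.
by rewrite /sqnormq /pureq /= expr0n add0r; exact: expr_sum3.
Qed.

Lemma has_gauss_mean_sqnorm m :
  has_gauss_mean (fun z => sqnormq (pureq z) ^+ m) (rising R 3 m).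
Proof.
have := has_gauss_mean_norm m 0 0 0.
rewrite (_ : \sum_(j < m.+1) _ = rising R 3 m).
  by apply: has_gauss_mean_eq => z; rewrite !expr0 !mulr1.
rewrite -[rising R 3 m]/(rising R (2 + 1) m) rising_conv; apply: eq_bigr => j _; congr (_ * _).
rewrite -[rising R 2 _]/(rising R (1 + 1) _) rising_conv mulr_suml; apply: eq_bigr => i _.
by rewrite !addn0 !gauss_coef_double !mulrA.
Qed.

Lemma has_gauss_mean_odd m a b c : odd a || odd b || odd c ->
  has_gauss_mean (fun z => sqnormq (pureq z) ^+ m * (z.1.1 ^+ a * z.1.2 ^+ b * z.2 ^+ c)) 0.
Proof.
move=> oabc; have := has_gauss_mean_norm m a b c.
rewrite (_ : \sum_(j < m.+1) _ = 0) // big1 // => j _.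
rewrite big1 ?mulr0 // => i _.
have g0 n d : odd d -> gc 1 (n.*2 + d) = 0.
  by move=> od; rewrite /gauss_coef oddD odd_double od.
by case/orP: oabc => [/orP[]|] /g0 ->; rewrite !(mul0r, mulr0).
Qed.

Definition has_gauss_meanq (g : R3 R -> quat R) (v : quat R) :=
  [/\ has_gauss_mean (fun z => qre (g z)) (qre v),
      has_gauss_mean (fun z => qi (g z)) (qi v),
      has_gauss_mean (fun z => qj (g z)) (qj v) &
      has_gauss_mean (fun z => qk (g z)) (qk v)].

Lemma has_gauss_meanq_eq f g v : f =1 g -> has_gauss_meanq f v -> has_gauss_meanq g v.
Proof. by move=> /funext ->. Qed.

Lemma mu_integralqE g v : has_gauss_meanq g v -> mu_integralq g = v.
Proof. by case: v => a b c d [[_ h1] [_ h2] [_ h3] [_ h4]]; congr Quat. Qed.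

Lemma has_gauss_meanqD f g u v : has_gauss_meanq f u -> has_gauss_meanq g v ->
  has_gauss_meanq (fun z => f z + g z) (u + v).
Proof.
by move=> [f1 f2 f3 f4] [g1 g2 g3 g4]; split; exact: has_gauss_meanD.
Qed.

Lemma has_gauss_meanq0 : has_gauss_meanq (fun=> 0) 0.
Proof. by split; exact: has_gauss_mean0. Qed.

Lemma has_gauss_meanq_sum (I : Type) (r : seq I) (f : I -> R3 R -> quat R)
    (u : I -> quat R) :
  (forall i, has_gauss_meanq (f i) (u i)) ->
  has_gauss_meanq (fun z => \sum_(i <- r) f i z) (\sum_(i <- r) u i).
Proof.
move=> fu; elim: r => [|i r ih].
  rewrite big_nil; apply: has_gauss_meanq_eq has_gauss_meanq0.
  by move=> z; rewrite big_nil.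
rewrite big_cons; apply: has_gauss_meanq_eq (has_gauss_meanqD (fu i) ih).
by move=> z; rewrite big_cons.
Qed.

Lemma has_gauss_mean_lin4 (f1 f2 f3 f4 g : R3 R -> R) (v1 v2 v3 v4 v : R) a1 a2 a3 a4 :
  has_gauss_mean f1 v1 -> has_gauss_mean f2 v2 -> has_gauss_mean f3 v3 ->
  has_gauss_mean f4 v4 ->
  (forall z, g z = a1 * f1 z + a2 * f2 z + a3 * f3 z + a4 * f4 z) ->
  v = a1 * v1 + a2 * v2 + a3 * v3 + a4 * v4 -> has_gauss_mean g v.
Proof.
move=> h1 h2 h3 h4 gE ->.
apply: (has_gauss_mean_eq (fsym gE)).
by do 3 (apply: has_gauss_meanD; last exact: has_gauss_meanZ); exact: has_gauss_meanZ.
Qed.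

Lemma has_gauss_meanqMl c f u : has_gauss_meanq f u ->
  has_gauss_meanq (fun z => c * f z) (c * u).
Proof.
case: c => c0 c1 c2 c3; case=> f0 f1 f2 f3; split.
- by apply: (has_gauss_mean_lin4 (a1 := c0) (a2 := - c1) (a3 := - c2) (a4 := - c3)
    f0 f1 f2 f3) => [z|] /=; ring.
- by apply: (has_gauss_mean_lin4 (a1 := c1) (a2 := c0) (a3 := - c3) (a4 := c2)
    f0 f1 f2 f3) => [z|] /=; ring.
- by apply: (has_gauss_mean_lin4 (a1 := c2) (a2 := c3) (a3 := c0) (a4 := - c1)
    f0 f1 f2 f3) => [z|] /=; ring.
- by apply: (has_gauss_mean_lin4 (a1 := c3) (a2 := - c2) (a3 := c1) (a4 := c0)
    f0 f1 f2 f3) => [z|] /=; ring.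
Qed.

Lemma has_gauss_meanqMr c f u : has_gauss_meanq f u ->
  has_gauss_meanq (fun z => f z * c) (u * c).
Proof.
case: c => c0 c1 c2 c3; case=> f0 f1 f2 f3; split.
- by apply: (has_gauss_mean_lin4 (a1 := c0) (a2 := - c1) (a3 := - c2) (a4 := - c3)
    f0 f1 f2 f3) => [z|] /=; ring.
- by apply: (has_gauss_mean_lin4 (a1 := c1) (a2 := c0) (a3 := c3) (a4 := - c2)
    f0 f1 f2 f3) => [z|] /=; ring.
- by apply: (has_gauss_mean_lin4 (a1 := c2) (a2 := - c3) (a3 := c0) (a4 := c1)
    f0 f1 f2 f3) => [z|] /=; ring.
- by apply: (has_gauss_mean_lin4 (a1 := c3) (a2 := c2) (a3 := - c1) (a4 := c0)
    f0 f1 f2 f3) => [z|] /=; ring.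
Qed.

(** Even powers are real, with mean (-1)^m (2m+1)!!; odd ones have odd coordinates. Both agree with
    minus the moment of index n + 2 for variance -1, which turns quaternionic orthogonality into a
    scalar problem. *)
Lemma has_gauss_meanq_exp n :
  has_gauss_meanq (fun z => pureq z ^+ n) (qr (- gc (-1) n.+2)).
Proof.
have N m := has_gauss_mean_sqnorm m; have O m := has_gauss_mean_odd m.
rewrite -(odd_double_half n); set m := n./2; case: (odd n).
  rewrite add1n; have -> : gc (-1) m.*2.+3 = 0 by rewrite /gauss_coef /= odd_double.
  rewrite oppr0 rmorph0; apply: (@has_gauss_meanq_eq (fun z =>
      qr ((-1) ^+ m) * (qr (sqnormq (pureq z) ^+ m) * pureq z))).
    by move=> z; rewrite (pureq_expE z m).2 rmorphM mulrA.
  rewrite -(mulr0 (qr ((-1) ^+ m))); apply: has_gauss_meanqMl; split.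
  - by apply: has_gauss_mean_eq (has_gauss_mean0 R) => z /=; ring.
  - by apply: has_gauss_mean_eq (O m 1%N 0%N 0%N isT) => z /=; ring.
  - by apply: has_gauss_mean_eq (O m 0%N 1%N 0%N isT) => z /=; ring.
  - by apply: has_gauss_mean_eq (O m 0%N 0%N 1%N isT) => z /=; ring.
rewrite add0n.
have -> : qr (- gc (-1) m.*2.+2) = qr ((-1) ^+ m) * qr (rising R 3 m).
  rewrite -rmorphM /gauss_coef /= odd_double /= doubleK risingSl; congr (qr _).
  by rewrite exprS; ring.
apply: (@has_gauss_meanq_eq (fun z => qr ((-1) ^+ m) * qr (sqnormq (pureq z) ^+ m))).
  by move=> z; rewrite (pureq_expE z m).1 rmorphM.
apply: has_gauss_meanqMl; split; first exact: N.
all: exact: has_gauss_mean0.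
Qed.

(** Conjugating z^k only gives (-1)^k z^k; the coefficients stay outside, one on each side. *)
Lemma innerE (p q : {poly quat R}) :
  inner p q = \sum_(k < size p) \sum_(l < size q)
    conjq p`_k * qr ((-1) ^+ k.+1 * gc (-1) (k + l).+2) * q`_l.
Proof.
apply: mu_integralqE.
have H (k l : nat) : has_gauss_meanq
    (fun z => conjq p`_k * (qr ((-1) ^+ k) * pureq z ^+ (k + l)) * q`_l)
    (conjq p`_k * qr ((-1) ^+ k.+1 * gc (-1) (k + l).+2) * q`_l).
  apply: has_gauss_meanqMr; apply: has_gauss_meanqMl.
  have -> : (-1) ^+ k.+1 * gc (-1) (k + l).+2 = (-1) ^+ k * - gc (-1) (k + l).+2.
    by rewrite exprS; ring.
  by rewrite rmorphM; apply: has_gauss_meanqMl; exact: has_gauss_meanq_exp.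
have := has_gauss_meanq_sum (index_enum 'I_(size p)) (fun k =>
  has_gauss_meanq_sum (index_enum 'I_(size q)) (fun l => H k l)).
apply: has_gauss_meanq_eq => z.
rewrite /reval raddf_sum /= mulr_suml; apply: eq_bigr => k _.
rewrite mulr_sumr; apply: eq_bigr => l _.
have -> : qr ((-1) ^+ k) = (-1) ^+ k by rewrite rmorphXn rmorphN1.
by rewrite conjqM conjqX conjq_pureq (exprNn (pureq z)) exprD !mulrA.
Qed.

End QuaternionMean.

(** * Orthogonal quaternionic polynomials *)

(* The monic orthogonal polynomials, with the signs produced by [z^2 = -|z|^2]:
   the recursion of the generalized Hermite polynomials of weight
   [x^2 exp (- x^2 / 2)]. *)
Fixpoint ghermite (R : comNzRingType) (n : nat) : {poly R} :=
  match n with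
  | 0 => 1
  | n1.+1 => match n1 with
    | 0 => 'X
    | n2.+1 => 'X * ghermite R n1 + (if odd n1 then n1.+2 else n1)%:R * ghermite R n2
    end
  end.

Arguments ghermite : simpl never.

(** Christoffel's formula for multiplying the weight by x^2. For even n, X q_n is H_(n+1) itself;
    for odd n the term H_n / X corrects the value at 0. *)
Lemma ghermite_hermite (R : comNzRingType) n :
  'X ^+ 2 * ghermite R n = 'X * hermite (-1) n.+1 - (odd n)%:R * hermite (-1) n.
Proof.
have N1 : (-1)%:P = -1 :> {poly R} by rewrite polyCN.
suff : ('X ^+ 2 * ghermite R n = 'X * hermite (-1) n.+1 - (odd n)%:R * hermite (-1) n) /\
  ('X ^+ 2 * ghermite R n.+1 = 'X * hermite (-1) n.+2 - (odd n.+1)%:R * hermite (-1) n.+1).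
  by case.
elim: n => [|n [ih1 ih2]].
  rewrite (hermiteS (-1) 1) /= N1 hermite1 hermite0 /ghermite /=; split; ring.
split=> //.
have -> : ghermite R n.+2 =
  'X * ghermite R n.+1 + (if odd n.+1 then n.+3 else n.+1)%:R * ghermite R n by [].
rewrite mulrDr mulrCA ih2 [_ ^+ 2 * (_ * _)]mulrCA ih1.
rewrite (hermiteS (-1) n.+2) (hermiteS (-1) n.+1) /= N1.
by case: (odd n) => /=; ring.
Qed.

Lemma gauss_mean_shift (R : comNzRingType) (e : R) k (p : {poly R}) :
  gauss_mean e ('X^k * p) = \sum_(i < size p) p`_i * gauss_coef e (k + i).
Proof.
rewrite (@gauss_meanE _ _ (k + size p)); last first.
  by rewrite (leq_trans (size_polyMleq _ _)) // size_polyXn.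
rewrite big_split_ord /= big1 ?add0r => [|i _]; last first.
  by rewrite coefXnM ltn_ord mul0r.
by apply: eq_bigr => i _; rewrite coefXnM ltnNge leq_addr addKn.
Qed.

Section OrthogonalPolynomials.
Variable R : realType.
Local Notation Q := (ghermite R).
Local Notation qr := (@quat_real R).
Local Notation gc := (@gauss_coef R (-1)).
Local Notation L := (@gauss_mean R (-1)).

Lemma size_ghermite n : size (Q n) = n.+1 /\ lead_coef (Q n) = 1.
Proof.
elim/ltn_ind: n => -[|[|n]] ih.
- by rewrite /ghermite size_poly1 lead_coef1.
- by rewrite /ghermite size_polyX lead_coefX.
have -> : Q n.+2 = 'X * Q n.+1 + (if odd n.+1 then n.+3 else n.+1)%:R * Q n by [].
have [s1 l1] := ih n.+1 (ltnSn _); have [s0 _] := ih n (ltnW (ltnSn _)).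
have Q10 : Q n.+1 != 0 by rewrite -size_poly_eq0 s1.
have sz : (size ((if odd n.+1 then n.+3 else n.+1)%:R * Q n)%R < size ('X * Q n.+1)%R)%N.
  rewrite (mulrC 'X) size_mulX // s1 -polyC1 -polyCMn mul_polyC.
  by rewrite (leq_ltn_trans (size_scale_leq _ _)) // s0.
rewrite size_polyDl // lead_coefDl // (mulrC 'X) size_mulX // s1.
by rewrite lead_coefM lead_coefX mulr1 l1.
Qed.

Definition ghermite_norm n : R := (n.+1`! + odd n * n`!)%:R.

Lemma ghermite_norm_gt0 n : 0 < ghermite_norm n.
Proof. by rewrite ltr0n addn_gt0 fact_gt0. Qed.

Lemma gauss_mean_ghermite n j : (j <= n)%N ->
  L ('X^(j.+2) * Q n) = if j == n then (-1) ^+ n.+1 * ghermite_norm n else 0.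
Proof.
move=> jn.
have -> : 'X^(j.+2) * Q n = hermite (-1) n.+1 * 'X^(j.+1)
    - (odd n)%:R%:P * (hermite (-1) n * 'X^j).
  have := ghermite_hermite R n => e.
  rewrite -addn2 exprD -mulrA e exprS polyCMn polyC1; ring.
rewrite gauss_meanB gauss_meanZ !gauss_mean_hermiteX // eqSS.
case: eqP => _; last by rewrite mulr0 subr0.
by rewrite /ghermite_norm natrD natrM exprS; ring.
Qed.

Lemma innerXE j (q : {poly quat R}) :
  inner 'X^j q = \sum_(l < size q) qr ((-1) ^+ j.+1 * gc (j + l).+2) * q`_l.
Proof.
rewrite innerE size_polyXn big_ord_recr /= big1 ?add0r => [|k _].
  by apply: eq_bigr => l _; rewrite coefXn eqxx conjq1 mul1r.
rewrite big1 // => l _; rewrite coefXn ltn_eqF //.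
by rewrite raddf0 !mul0r.
Qed.

Lemma inner_sum (p q : {poly quat R}) :
  inner p q = \sum_(k < size p) conjq p`_k * inner 'X^k q.
Proof.
rewrite innerE; apply: eq_bigr => k _; rewrite innerXE mulr_sumr.
by apply: eq_bigr => l _; rewrite mulrA.
Qed.

Lemma inner_sumr (p q : {poly quat R}) :
  inner p q = \sum_(l < size q) inner p 'X^l * q`_l.
Proof.
rewrite innerE exchange_big /=; apply: eq_bigr => l _.
rewrite inner_sum mulr_suml; apply: eq_bigr => k _.
rewrite innerXE size_polyXn big_ord_recr /= big1 ?add0r => [|i _].
  by rewrite coefXn eqxx mulr1.
by rewrite coefXn ltn_eqF // mulr0.
Qed.

Lemma innerXB j (p q : {poly quat R}) : inner 'X^j (p - q) = inner 'X^j p - inner 'X^j q.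
Proof.
have ext m (r : {poly quat R}) : (size r <= m)%N ->
    inner 'X^j r = \sum_(l < m) qr ((-1) ^+ j.+1 * gc (j + l).+2) * r`_l.
  move=> rm; rewrite innerXE.
  rewrite -!(big_mkord xpredT (fun l => qr ((-1) ^+ j.+1 * gc (j + l).+2) * r`_l)).
  rewrite [RHS](big_cat_nat (leq0n _) rm) /=.
  rewrite [X in _ = _ + X](_ : _ = 0) ?addr0 // big_nat_cond big1 // => i.
  by rewrite andbT => /andP[ri _]; rewrite nth_default // mulr0.
rewrite (ext (maxn (size p) (size q))); last first.
  by rewrite (leq_trans (size_polyD _ _)) // size_polyN.
rewrite (ext _ _ (leq_maxl (size p) (size q))) (ext _ _ (leq_maxr (size p) (size q))).
by rewrite -sumrB; apply: eq_bigr => l _; rewrite coefB mulrBr.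
Qed.

Lemma innerX_real j (p : {poly R}) :
  inner 'X^j (map_poly qr p) = qr ((-1) ^+ j.+1 * L ('X^(j.+2) * p)).
Proof.
have qr_inj : injective qr by move=> a b [].
rewrite innerXE (size_map_inj_poly qr_inj (rmorph0 _)).
rewrite (@gauss_mean_shift _ _ j.+2) mulr_sumr rmorph_sum; apply: eq_bigr => l _.
rewrite coef_map -rmorphM; congr (qr _); rewrite !addSn; ring.
Qed.

(** The signs (-1)^j and (-1)^k differ only if j + k is odd, and then the moment vanishes. *)
Lemma inner_realX j (p : {poly R}) :
  inner (map_poly qr p) 'X^j = inner 'X^j (map_poly qr p).
Proof.
have qr_inj : injective qr by move=> a b [].
rewrite inner_sum innerXE !(size_map_inj_poly qr_inj (rmorph0 _)).
apply: eq_bigr => k _; rewrite innerXE size_polyXn big_ord_recr /= big1 ?add0r.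
  rewrite coefXn eqxx mulr1 coef_map conjq_real -!rmorphM; congr (qr _).
  rewrite mulrC addnC; congr (_ * _); rewrite /gauss_coef /= negbK.
  case: ifPn; rewrite ?mulr0 // oddD => ojk.
  congr (_ * _); rewrite -signr_odd -[in RHS]signr_odd /=.
  by case: (odd j) (odd k) ojk => [] [].
by move=> l _; rewrite coefXn ltn_eqF // mulr0.
Qed.

Lemma inner_ghermite n j : (j <= n)%N ->
  inner 'X^j (map_poly qr (Q n)) = if j == n then qr (ghermite_norm n) else 0.
Proof.
move=> jn; rewrite innerX_real gauss_mean_ghermite //.
case: eqP => [->|_]; last by rewrite mulr0 rmorph0.
by rewrite mulrA -exprMn mulrNN mulr1 expr1n mul1r.
Qed.

(** Both families are monic and orthogonal to all lower powers, so the difference D has degree below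
    n and the same orthogonality. *)
Lemma ghermite_unique (P : nat -> {poly quat R}) :
  monic_orthogonal_system P -> forall n, P n = map_poly qr (Q n).
Proof.
move=> [Pm Porth] n.
have qr_inj : injective qr by move=> a b [].
have szQ m : size (map_poly qr (Q m)) = m.+1.
  by rewrite (size_map_inj_poly qr_inj (rmorph0 _)) (size_ghermite m).1.
have PX j : (j < n)%N -> inner 'X^j (P n) = 0.
  elim/ltn_ind: j => j ih jn.
  have [/monicP lc sz] := Pm j.
  have /eqP : inner (P j) (P n) = 0 by apply: Porth => e; rewrite e ltnn in jn.
  rewrite inner_sum sz big_ord_recr /= big1 ?add0r => [|k _]; last first.
    by rewrite ih ?mulr0 // (ltn_trans _ jn).
  have -> : (P j)`_j = 1 by rewrite -lc lead_coefE sz.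
  by rewrite conjq1 mul1r => /eqP.
set D := P n - map_poly qr (Q n).
have DX j : (j < n)%N -> inner 'X^j D = 0.
  move=> jn; rewrite innerXB PX // inner_ghermite ?(ltnW jn) //.
  by rewrite ltn_eqF // subr0.
have [/monicP lcP szP] := Pm n; have [sQ lcQ] := size_ghermite n.
have szD : (size D <= n)%N.
  apply/leq_sizeP => i; rewrite leq_eqVlt => /predU1P[<-|ni].
    rewrite coefB coef_map; move: lcP lcQ; rewrite !lead_coefE szP sQ /= => -> ->.
    by rewrite rmorph1 subrr.
  by rewrite nth_default // (leq_trans (size_polyD _ _)) // size_polyN szP szQ maxnn.
apply/eqP; rewrite -subr_eq0 -/D; apply: contraT => D0.
(* Expanding <Q_d, D> on the left gives 0 since d < n; on the right only the norm of Q_d times the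
   leading coefficient of D survives. *)
pose d := (size D).-1.
have sD : size D = d.+1 by rewrite prednK // lt0n size_poly_eq0.
have : inner (map_poly qr (Q d)) D = 0.
  rewrite inner_sum szQ big1 // => k _; rewrite DX ?mulr0 //.
  by rewrite (leq_trans (ltn_ord k)) // -sD.
rewrite inner_sumr sD big_ord_recr /= big1 ?add0r => [|l _]; last first.
  by rewrite inner_realX inner_ghermite ?(ltnW (ltn_ord l)) // ltn_eqF // mul0r.
rewrite inner_realX inner_ghermite // eqxx => /(congr1 ( *%R (qr (ghermite_norm d)^-1))).
rewrite mulr0 mulrA -rmorphM mulVf ?gt_eqF ?ghermite_norm_gt0 // rmorph1 mul1r.
by move=> Dd; move: D0; rewrite -lead_coef_eq0 lead_coefE sD Dd eqxx.
Qed.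

Lemma inner_ghermite_self n :
  inner (map_poly qr (Q n)) (map_poly qr (Q n)) = qr (ghermite_norm n).
Proof.
have qr_inj : injective qr by move=> a b [].
rewrite inner_sum (size_map_inj_poly qr_inj (rmorph0 _)).
have [sQ lcQ] := size_ghermite n.
rewrite sQ big_ord_recr /= big1 ?add0r => [|k _]; last first.
  by rewrite inner_ghermite ?(ltnW (ltn_ord k)) // ltn_eqF // mulr0.
rewrite inner_ghermite // eqxx coef_map conjq_real; move: lcQ.
by rewrite lead_coefE sQ /= => ->; rewrite rmorph1 mul1r.
Qed.

End OrthogonalPolynomials.

(** * The kernel on the diagonal *)

Section Kernel.
Variable R : realType.
Local Notation qr := (@quat_real R).
Local Notation H := (hermite (-1 : R)).
Local Notation Q := (ghermite R).
Local Notation F := (@weighted_christoffel R).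

Lemma reval_real (p : {poly R}) (x : R3 R) :
  reval (map_poly qr p) x = (map_poly qr p).[pureq x].
Proof.
rewrite horner_coef; apply: eq_bigr => k _.
by rewrite coef_map; apply/esym; exact: quat_realC.
Qed.

Section Evaluation.
Variables (z om : quat R) (r : R).
Hypotheses (zE : z = qr r * om) (om2 : om ^+ 2 = -1).

Lemma quat_real_commr : commr_rmorph qr z.
Proof. by move=> a; apply/commr_sym; exact: quat_realC. Qed.
Local Notation ev := (horner_morph quat_real_commr).

Let omSS n : om ^+ n.+2 = - om ^+ n.
Proof. by rewrite -addn2 exprD om2 mulrN1. Qed.

Let z_mul a n : z * (qr a * om ^+ n) = qr (r * a) * om ^+ n.+1.
Proof. by rewrite zE exprS rmorphM !mulrA -(mulrA _ om) -(quat_realC a om) !mulrA. Qed.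

(** The quaternion [om] plays the part of i: at z = r om the variance -1 turns back into variance 1
    at r. *)
Lemma eval_hermite n : ev (H n) = qr (herm n r) * om ^+ n.
Proof.
elim/ltn_ind: n => -[|[|n]] ih.
- by rewrite hermite0 rmorph1 herm0 rmorph1 mul1r.
- by rewrite hermite1 horner_morphX hermS herm0 /= mulr1 mul0r subr0 zE.
rewrite hermiteS polyCN polyC1 mulN1r mulNr opprK rmorphD !rmorphM /= rmorph_nat.
rewrite horner_morphX ih // ih 1?ltnW // z_mul (hermS n.+1) /=.
rewrite omSS -(rmorph_nat qr) mulrA -rmorphM.
have -> : - om ^+ n = (-1) * om ^+ n by rewrite mulN1r.
rewrite !mulrA -(rmorphN1 qr) -!rmorphM -mulrDl -rmorphD; congr (qr _ * _).
by ring.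
Qed.

Lemma eval_ghermite n : z ^+ 2 * ev (Q n) =
  - (qr (r * herm n.+1 r + (odd n)%:R * herm n r) * om ^+ n).
Proof.
have := congr1 ev (ghermite_hermite R n).
rewrite rmorphB !rmorphM /= horner_morphX !eval_hermite z_mul omSS rmorph_nat.
rewrite expr2 => ->.
by rewrite mulrN -opprD mulrA -(rmorph_nat qr) -rmorphM -mulrDl -rmorphD.
Qed.

End Evaluation.

Lemma sqnormq_ghermite (x : R3 R) r n : r != 0 -> sqnormq (pureq x) = r ^+ 2 ->
  sqnormq (reval (map_poly qr (Q n)) x) * r ^+ 2 =
  (herm n.+1 r + (odd n)%:R * herm n r / r) ^+ 2.
Proof.
move=> r0 xr; pose om := qr r^-1 * pureq x.
have zE : pureq x = qr r * om by rewrite mulrA -rmorphM mulfV // rmorph1 mul1r.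
have om2 : om ^+ 2 = -1.
  rewrite exprMn_comm; last exact: quat_realC.
  rewrite sqr_pureq xr -rmorphXn -rmorphM -[RHS](rmorphN1 qr); congr (qr _).
  by field.
have om1 : sqnormq om = 1.
  by rewrite /om sqnormqM sqnormq_real xr; field.
have om1n k : sqnormq (om ^+ k) = 1.
  elim: k => [|k ih]; last by rewrite exprS sqnormqM om1 ih mulr1.
  by rewrite expr0 -(rmorph1 qr) sqnormq_real expr1n.
rewrite reval_real -[_.[_]]/(horner_morph (quat_real_commr (pureq x)) (Q n)).
set v := horner_morph _ _.
have := congr1 (@sqnormq R) (eval_ghermite zE om2 n).
rewrite -mulN1r -(rmorphN1 qr) !sqnormqM -/v om1n !sqnormq_real xr => e.
apply: (mulfI (expf_neq0 2 r0)).
have -> : r ^+ 2 * (sqnormq v * r ^+ 2) = r ^+ 2 * r ^+ 2 * sqnormq v by ring.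
by rewrite e; field.
Qed.

(** Christoffel-Darboux at 0 involves degrees n + 1 and n + 2; only the even one is nonzero at 0,
    which leaves the odd one evaluated at r. *)
Definition last_odd n := if odd n then n.+2 else n.+1.

(* The polynomials [x q], [deg q <= n], are those of degree at most [n + 1]
   vanishing at 0: their kernel is a rank one perturbation of the Hermite
   kernel, and by the Christoffel-Darboux formula at 0 the perturbation
   involves a single odd Hermite polynomial. *)
Lemma sum_ghermite_norm (r : R) n : r != 0 ->
  \sum_(k < n.+1) (herm k.+1 r + (odd k)%:R * herm k r / r) ^+ 2 / ghermite_norm R k
  = christoffel n.+2 r -
    (christoffel (last_odd n).+1 r - christoffel (last_odd n) r) / r ^+ 2.
Proof.
move=> r0; elim: n => [|n ih].
  rewrite big_ord1 /last_odd /ghermite_norm /= !christoffelS /christoffel big_ord0.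
  by rewrite !hermS !herm0 /= !fact0 !factS !fact0; field.
rewrite big_ord_recr /= ih /last_odd /ghermite_norm /=.
case: (odd n) => /=.
  (* For odd n, [last_odd] does not move and the new term is a plain Hermite one. *)
  rewrite [X in _ = X - _]christoffelS !mul0r addr0 mul0n addn0; ring.
(* For even n, [last_odd] jumps from n + 1 to n + 3. *)
rewrite !mul1r mul1n !(christoffelS n.+3) !(christoffelS n.+2) !(christoffelS n.+1).
rewrite (hermS n.+2) /=.
have E3 : n.+3%:R = n%:R + 3 :> R by rewrite -natrD addn3.
have E2 : n.+2%:R = n%:R + 2 :> R by rewrite -natrD addn2.
have F2 : n.+2`!%:R = (n%:R + 2) * n.+1`!%:R :> R by rewrite factS natrM E2.
have F3 : n.+3`!%:R = (n%:R + 3) * ((n%:R + 2) * n.+1`!%:R) :> R.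
  by rewrite factS natrM E3 F2.
have FD : (n.+2`! + n.+1`!)%:R = (n%:R + 3) * n.+1`!%:R :> R by rewrite natrD F2; ring.
have f0 := factR_neq0 R n.+1.
have n3 : n%:R + 3 != 0 :> R by rewrite -E3.
have n2 : n%:R + 2 != 0 :> R by rewrite -E2.
rewrite FD F3 F2 E2; move: f0; move: (n.+1`!%:R) => f f0.
by field; rewrite r0 f0 n2 n3.
Qed.

End Kernel.

(** * The radial density in terms of the Hermite kernel *)

Section RadialDensity.
Variable R : realType.
Local Notation mu := (@lebesgue_measure R).
Local Notation qr := (@quat_real R).
Local Notation F := (@weighted_christoffel R).
Variable P : nat -> {poly quat R}.
Hypothesis hP : monic_orthogonal_system P.

Lemma pf_kernel_diag (x : R3 R) (r : R) n : r != 0 ->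
  sqnormq (pureq x) = r ^+ 2 ->
  r ^+ 2 * qre (pf_kernel P n x x) = christoffel n.+2 r -
    (christoffel (last_odd n).+1 r - christoffel (last_odd n) r) / r ^+ 2.
Proof.
move=> r0 xr; rewrite -sum_ghermite_norm //.
have -> : pf_kernel P n x x = qr (\sum_(k < n.+1)
    sqnormq (reval (map_poly qr (ghermite R k)) x) / ghermite_norm R k).
  rewrite rmorph_sum; apply: eq_bigr => k _.
  rewrite (ghermite_unique hP) inner_ghermite_self (mulq_conj_real _).1.
  have h0 : ghermite_norm R k != 0 by rewrite gt_eqF // ghermite_norm_gt0.
  by rewrite rmorphM rmorphV ?unitfE.
have qreE a : qre (qr a) = a by [].
rewrite qreE mulr_sumr; apply: eq_bigr => k _.
by rewrite mulrA [r ^+ 2 * _]mulrC sqnormq_ghermite.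
Qed.

Lemma sqnormq_sphere (r : R) t : sqnormq (pureq (sphere_point r t)) = r ^+ 2.
Proof.
rewrite /sqnormq /= !exprMn !sin2cos2; ring.
Qed.

Lemma integral_sin : \int[mu]_(x in `[0, pi]) sin x = 2.
Proof.
rewrite /Rintegral (@continuous_FTC2 _ sin (fun x => - cos x)).
- by rewrite cospi cos0 /=; ring.
- exact: pi_gt0.
- exact/continuous_subspaceT/continuous_sin.
- apply: (@derivable_LRcontinuous _ _ sin) => x.
  by apply: is_derive_eq; rewrite opprK.
- move=> x _; rewrite derive1E; apply: derive_val.
  by apply: is_derive_eq; rewrite opprK.
Qed.

Lemma sphere_integral_cst (r c : R) (g : R3 R -> R) :
  (forall t, g (sphere_point r t) = c) -> sphere_integral r g = 4 * pi * r ^+ 2 * c.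
Proof.
move=> gc; rewrite /sphere_integral Rintegral_mkcond.
pose f := (fun x : R => sin x) \_ `[0, pi].
pose h := (fun=> 1 : R) \_ (`[0, 2 * pi] : set R).
have Icc (k : R -> R) (a b : R) : continuous k ->
    mu.-integrable setT (EFin \o k \_ `[a, b]).
  move=> ck; rewrite -restrict_EFin; apply/integrable_restrict => //=.
  rewrite setTI; apply: continuous_compact_integrable; first exact: segment_compact.
  exact: continuous_subspaceT.
have If : mu.-integrable setT (EFin \o f) by apply: Icc; exact: continuous_sin.
have Ih : mu.-integrable setT (EFin \o h) by apply: Icc => x; exact: cvg_cst.
have [I E] := integrable_prod If Ih.
have -> : (fun t => g (sphere_point r t) * (r ^+ 2 * sin t.1)) \_ (`[0, pi] `*` `[0, 2 * pi])
    = (fun t : R * R => c * r ^+ 2 * (f t.1 * h t.2)).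
  apply/funext => -[a b]; rewrite /f /h !patchE gc /= in_setX /=.
  by case: (a \in _); case: (b \in _); rewrite /= ?(mulr0, mul0r, mulr1) ?mulrA.
rewrite RintegralZl // E -!Rintegral_mkcond integral_sin Rintegral_cst //=.
rewrite lebesgue_measure_itv /= lte_fin mulr_gt0 ?pi_gt0 //= subr0 /=.
ring.
Qed.

(** The r^2 of the area cancels that of the kernel, and 4 pi c^3 = 2 c for c = (2 pi)^(-1/2). *)
Lemma radial_densityE n (r : R) : 0 < r ->
  radial_density P n r = 2 * gauss_cst R *
    (F n.+2 r - (F (last_odd n).+1 r - F (last_odd n) r) / r ^+ 2).
Proof.
move=> r0; rewrite /radial_density.
pose T := christoffel n.+2 r -
    (christoffel (last_odd n).+1 r - christoffel (last_odd n) r) / r ^+ 2.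
have rn0 : r != 0 by rewrite gt_eqF.
rewrite (@sphere_integral_cst r (T / r ^+ 2 * (gauss_cst R ^+ 3 * gauss_weight r))); last first.
  move=> t; have xr := sqnormq_sphere r t.
  rewrite /density /T -(pf_kernel_diag n rn0 xr).
  rewrite (mulrC (r ^+ 2)) mulfK ?expf_neq0 //; congr (_ * _).
  by rewrite /gauss powR_gauss_cst xr.
have c2 : gauss_cst R ^+ 2 = (2 * pi)^-1.
  by rewrite /gauss_cst exprVn sqr_sqrtr // mulr_ge0 ?pi_ge0.
have pi0 : (pi : R) != 0 by rewrite gt_eqF ?pi_gt0.
have -> : 2 * gauss_cst R * (F n.+2 r - (F (last_odd n).+1 r - F (last_odd n) r) / r ^+ 2) =
   2 * gauss_cst R * (gauss_weight r * T).
  by rewrite /T /weighted_christoffel -/(gauss_weight r); ring.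
rewrite (exprS (gauss_cst R) 2) c2.
move: pi0; move: (pi : R) (gauss_weight r) (gauss_cst R) T => p w c T' p0.
by field; rewrite p0 rn0.
Qed.

End RadialDensity.

Theorem corollary5p9 (R : realType) (P : nat -> {poly quat R})
    (hP : monic_orthogonal_system P) (s : R) (hs : 0 < s) :
  (s < 1 ->
    (1 / (2 * Num.sqrt n%:R) * radial_density P n (2 * Num.sqrt n%:R * s) : R)
      @[n --> \oo] --> (1 / pi * Num.sqrt (1 - s ^+ 2) : R)) /\
  (1 < s ->
    (1 / (2 * Num.sqrt n%:R) * radial_density P n (2 * Num.sqrt n%:R * s) : R)
      @[n --> \oo] --> (0 : R)).
Proof.
pose r (n : nat) : R := 2 * Num.sqrt n%:R * s.
pose F n := @weighted_christoffel R n.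
pose c := gauss_cst R.
(* Both cases reduce to the weighted Hermite kernel, as the rank one term tends to 0 for every s >
   0. *)
have scaled (l : R) : F n.+2 (r n) / Num.sqrt n%:R @[n --> \oo] --> l ->
    1 / (2 * Num.sqrt n%:R) * radial_density P n (r n) @[n --> \oo] --> c * l.
  move=> Fl; have lo n : (last_odd n <= n.+2)%N by rewrite /last_odd; case: ifP.
  pose G n := F n.+2 (r n) / Num.sqrt n%:R -
    (F (last_odd n).+1 (r n) - F (last_odd n) (r n)) / r n ^+ 2 / Num.sqrt n%:R.
  have Gl : G n @[n --> \oo] --> l.
    rewrite -[l]subr0; apply: cvgB Fl _.
    exact: cvg_weighted_christoffel_correction hs lo.
  apply: (@cvg_eventually_eq R _ (fun n => c * G n)); last first.
    by apply: cvgM; [exact: cvg_cst | exact: Gl].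
  move=> n.
  have n0 : 0 < Num.sqrt n.+1%:R :> R by rewrite sqrtr_gt0.
  have r0 : 0 < r n.+1 by rewrite !mulr_gt0.
  rewrite radial_densityE // /G /F /c.
  move: r0 n0; move: (r n.+1) (Num.sqrt n.+1%:R) => x m x0 m0.
  by field; rewrite !gt_eqF.
split=> s1; last first.
  by rewrite -[X in _ --> X](mulr0 c); apply: scaled; exact: cvg_weighted_christoffel_outer.
have -> : 1 / pi * Num.sqrt (1 - s ^+ 2) =
    c * (Num.sqrt (2 / pi) * Num.sqrt (1 - s ^+ 2)) :> R.
  rewrite mulrA; congr (_ * _); rewrite /c /gauss_cst -sqrtrV ?mulr_ge0 ?pi_ge0 //.
  rewrite -sqrtrM ?invr_ge0 ?mulr_ge0 ?pi_ge0 //.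
  have -> : (2 * pi)^-1 * (2 / pi) = pi^-1 ^+ 2 :> R.
    have : (pi : R) != 0 by rewrite gt_eqF ?pi_gt0.
    by move: (pi : R) => p p0; field.
  by rewrite sqrtr_sqr ger0_norm ?invr_ge0 ?pi_ge0 // div1r.
by apply: scaled; exact: cvg_weighted_christoffel_bulk.
Qed.
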